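(* Let $(X_t)_{t\ge 0}$ be a non-negatively curved diffusion on a probability space $(E,\mathcal{E},\mu)$, starting from a deterministic state $x\in E$. Then for all $t>0$, $$\frac{\mathrm{d}}{\mathrm{d}t}\,\mathrm{Ent}(X_t)\ \le\ -\frac{\mathrm{Varent}(X_t)}{2t}.$$
   Context: Setting. Let $(E,\mathcal{E},\mu)$ be a probability space and $(P_t)_{t\ge 0}$ a strongly continuous Markov semigroup of self-adjoint operators on $L^2(\mu)$. Its infinitesimal generator is $Lf:=\lim_{t\to 0}\frac{P_tf-f}{t}$, defined for all $f\in L^2(\mu)$ such that the limit exists in $L^2(\mu)$; the set of such $f$ is $\mathrm{Dom}(L)$. The carré du champ operator is $\Gamma(f,g):=\frac12\left(L(fg)-fLg-gLf\right)$ for $f,g\in L^2(\mu)$ with $f,g,fg\in\mathrm{Dom}(L)$, and $\Gamma f:=\Gamma(f,f)$. Non-negatively curved diffusion. Let $x\in E$ be an arbitrary point and let $(X_t)_{t\ge 0}$ be a Markov process with generator $L$ (i.e. with transition semigroup $(P_t)_{t\ge0}$, $P_tf(y)=\mathbb{E}[f(X_t)\mid X_0=y]$) starting from $X_0=x$. It is called a non-negatively curved diffusion if: for each $t>0$, $X_t$ admits a density $f_t$ with respect to $\mu$; both $f_t$ and $\log f_t$ are in $\mathrm{Dom}(L)$, as well as their squares and their product; and the following two conditions hold when $f=f_t$, $g=\log f_t$ and $\phi=\log$, for each $t>0$: (i) chain rule: $\Gamma(\phi(f),g)=\phi'(f)\,\Gamma(f,g)$; (ii) non-negative curvature in the $\mathrm{CD}(0,\infty)$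 sense: $\Gamma P_s g\le P_s\Gamma g$ for all $s\ge 0$ (the expressions involved being understood to be well defined). Entropy and varentropy. For an $E$-valued random variable $X$ with density $f$ with respect to $\mu$, set $$\mathrm{Ent}(X):=\mathbb{E}[\log f(X)]=\int_E f\log f\,\mathrm{d}\mu,\qquad \mathrm{Varent}(X):=\mathrm{Var}(\log f(X))=\int_E f(\log f)^2\,\mathrm{d}\mu-\left(\int_E f\log f\,\mathrm{d}\mu\right)^2 .$$
   Formalization: The Markov property of the process is required with respect to the right-continuous filtration (including time 0+), which excludes a start at a μ-null branch point from which the process instantly enters one of several states at random; there the inequality can fail. *)

(* Defs.v *)
From HB Require Import structures.
From mathcomp Require Import all_boot all_order all_algebra.
From mathcomp Require Import all_classical all_reals all_analysis.
Set Implicit Arguments.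
Unset Strict Implicit.
Unset Printing Implicit Defensive.
Import Order.TTheory GRing.Theory Num.Theory.
Import numFieldNormedType.Exports.
Local Open Scope classical_set_scope.
Local Open Scope ring_scope.

(* Elements of L^2(mu) are represented by functions f \in Lfun mu 2%:E, and
   equalities and inequalities between them hold mu-almost everywhere. *)

Section semigroup.
Context (R : realType) (d : measure_display) (E : measurableType d).
Variables (mu : probability E R) (P : R -> R.-pker E ~> E).

(* P_t f (y) = E[f(X_t) | X_0 = y], the family P being used at times t >= 0
   only.  Through the kernel, P_t also acts on L^1(mu), the integral being then
   proper for mu-almost every y. *)
Definition semigroup_op (t : R) (f : E -> R) : E -> R :=
  fun y => \int[P t y]_z f z.

(* Compatibility with mu-a.e. equality is not listed: it follows from
   self-adjointness, which makes mu invariant. *)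
Definition symmetric_markov_semigroup : Prop :=
  [/\ forall (y : E) (A : set E), measurable A -> P 0 y A = \d_y A,
      forall (s t : R) (y : E) (A : set E), 0 <= s -> 0 <= t -> measurable A ->
        P (s + t) y A = (\int[P s y]_z P t z A)%E,
      forall (t : R) (f : E -> R), 0 <= t -> f \in Lfun mu 2%:E ->
        semigroup_op t f \in Lfun mu 2%:E,
      forall (t : R) (f g : E -> R), 0 <= t ->
        f \in Lfun mu 2%:E -> g \in Lfun mu 2%:E ->
        \int[mu]_y (semigroup_op t f y * g y) =
        \int[mu]_y (f y * semigroup_op t g y)
    & forall f : E -> R, f \in Lfun mu 2%:E ->
        'N[mu]_2%:E[EFin \o (semigroup_op t f \- f)%R]%E @[t --> 0^'+]
          --> (0 : \bar R)].

Definition is_generator_value (f h : E -> R) : Prop :=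
  [/\ f \in Lfun mu 2%:E, h \in Lfun mu 2%:E
    & 'N[mu]_2%:E[EFin \o (fun y => (semigroup_op t f y - f y) / t - h y)%R]%E
        @[t --> 0^'+] --> (0 : \bar R)].

Definition dom_generator : set (E -> R) :=
  [set f | exists h, is_generator_value f h].

(* A chosen representative of the class of L f when f is in the domain, and
   the null function otherwise. *)
Definition generator (f : E -> R) : E -> R :=
  xget (cst 0) [set h | is_generator_value f h].

Definition carre_du_champ (f g : E -> R) : E -> R :=
  fun y => 2^-1 * (generator (f \* g) y
                   - f y * generator g y - g y * generator f y).

Definition chain_rule (phi : R -> R) (f g : E -> R) : Prop :=
  carre_du_champ (phi \o f) g
    = (fun y => derive1 phi (f y) * carre_du_champ f g y) %[ae mu].

(* The first two conditions are those under which Gamma (P_s g) is defined. *)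
Definition nonneg_curvature (g : E -> R) : Prop :=
  forall s : R, 0 <= s ->
    [/\ dom_generator (semigroup_op s g),
        dom_generator (semigroup_op s g \* semigroup_op s g)
      & {ae mu, forall y,
          carre_du_champ (semigroup_op s g) (semigroup_op s g) y
            <= semigroup_op s (carre_du_champ g g) y}].

End semigroup.

Section process.
Context (R : realType) (d : measure_display) (E : measurableType d).
Context (d' : measure_display) (Om : measurableType d').
Variables (PP : probability Om R) (X : R -> Om -> E).

Definition natural_filtration (t : R) : set (set Om) :=
  <<s \bigcup_(r in `[0, t]) preimage_set_system setT (X r) measurable >>.

Definition right_filtration (s : R) : set (set Om) :=
  \bigcap_(u in `]s, +oo[) natural_filtration u.

(* As usual for diffusions, the Markov property is required with respect to
   the right-continuous filtration: for all s >= 0, including s = 0,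
   P(X_(s+t) \in B | F_(s+)) = P_t(X_s, B).  With respect to F_s alone it would
   allow x to be a branch point of the kernels, that is, a mu-null point whose
   transition kernels are a mixture of those of several other points; the
   almost everywhere conditions on the semigroup cannot detect such a point. *)
Definition markov_process (P : R -> R.-pker E ~> E) (x : E) : Prop :=
  [/\ forall t : R, 0 <= t -> measurable_fun setT (X t),
      {ae PP, forall w, X 0 w = x}
    & forall (s t : R) (A : set Om) (B : set E), 0 <= s -> 0 <= t ->
        right_filtration s A -> measurable B ->
        PP (A `&` X (s + t) @^-1` B) = (\int[PP]_(w in A) P t (X s w) B)%E].

End process.

Section entropy.
Context (R : realType) (d : measure_display) (E : measurableType d).
Context (d' : measure_display) (Om : measurableType d').
Variables (mu : probability E R) (PP : probability Om R).

Definition is_density (X : Om -> E) (f : E -> R) : Prop :=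
  [/\ measurable_fun setT f, forall y, 0 <= f y
    & forall A : set E, measurable A ->
        PP (X @^-1` A) = (\int[mu]_(y in A) (f y)%:E)%E].

Definition entropy (X : Om -> E) (f : E -> R) : R :=
  fine 'E_PP[@ln R \o f \o X]%E.

Definition varentropy (X : Om -> E) (f : E -> R) : R :=
  fine 'V_PP[@ln R \o f \o X]%E.

(* f t is any version of the density of X t.  Since ln vanishes on negative
   numbers and at 0, the condition 0 < f t y a.e. has to be added in order to
   express that log f_t is an element of L^2(mu). *)
Definition nonneg_curved_diffusion (P : R -> R.-pker E ~> E)
    (X : R -> Om -> E) (x : E) (f : R -> E -> R) : Prop :=
  markov_process PP X P x /\
  forall t : R, 0 < t ->
    let ft := f t in let gt := @ln R \o f t in
    [/\ is_density (X t) ft /\ {ae mu, forall y, 0 < ft y},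
        dom_generator mu P ft /\ dom_generator mu P gt,
        [/\ dom_generator mu P (ft \* ft), dom_generator mu P (gt \* gt)
          & dom_generator mu P (ft \* gt)],
        chain_rule mu P (@ln R) ft gt
      & nonneg_curvature mu P gt].

End entropy.

(* Main.v *)
(** Write [g = ln (f t)] and let [L], [Gamma] be the generator and the carre du
    champ. Two identities are combined.

    First, [f (t + k) = P_k (f t)], so that [f] is differentiable in L^2 with
    derivative [L (f t)]; convexity of [u ln u] squeezes the difference quotients
    of the entropy between integrals against [ln (f t)] and [ln (f (t + k))],
    hence [Ent' = \int g L (f t)], and by the chain rule and the symmetry of [L]
    this equals [- \int f t * Gamma g].

    Second, [s |-> \int f (t - s) * (P_s g)^2] has derivative
    [- 2 \int f (t - s) * Gamma (P_s g) >= - 2 \int f t * Gamma g] by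
    nonnegative curvature. At [s = 0] it is the second moment of [g (X t)]. At
    [s] it is that of [E (g (X t) | F_(t - s))], which tends to
    [(E g (X t))^2] as [s] tends to [t]: by the Markov property at time [0+] and
    since the initial state is deterministic, the limit of this backward
    martingale is constant. Hence the variance of [g (X t)] is at most
    [2 t \int f t * Gamma g]. *)
Require Import Defs.
From HB Require Import structures.
From mathcomp Require Import all_boot all_order all_algebra.
From mathcomp Require Import all_classical all_reals all_analysis.
From mathcomp Require Import measurable_realfun ring lra.
Set Implicit Arguments.
Unset Strict Implicit.
Unset Printing Implicit Defensive.
Import Order.TTheory GRing.Theory Num.Theory.
Import numFieldNormedType.Exports.
Local Open Scope classical_set_scope.
Local Open Scope ring_scope.

(** * Integrals of real functions *)

(** The assumptions give square-integrability but no regularity, and this dictates the modes of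
    convergence. Difference quotients of [f] converge strongly in L^2, whereas [ln (f (t + k))] and
    [(P_s g)^2] are only shown to be bounded in L^2 and to converge in L^1, hence weakly. Products
    are therefore arranged so that a strongly convergent factor meets a weakly convergent one. The
    uniform bounds come from Jensen's inequality; squares being in the domain puts [f r] and [P_s g]
    in L^4, so that [f r * P_s g] can be paired with [L (P_s g)].

    The generator is a limit at [0+] only. Two-sided derivatives at [t] come from writing
    [f (t + k)] as [P_(k + t / 2)] applied to [f (t / 2)].

    No density is given at time 0, so the interpolation lives on [0 < s < t] and its limit at [t]
    must come from the process. A limit along one sequence of times is enough. The times are chosen
    so that the increments of the martingale are summable in L^1; the events where it stays away
    from its mean are then tail events, which belong to [F_(0+)]. *)

Section real_integral.
Context d (T : measurableType d) (R : realType) (m : {measure set T -> \bar R}).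
Implicit Types f g : T -> R.
Local Notation intg f := (m.-integrable setT (EFin \o f)).

Lemma intg_measurable f : intg f -> measurable_fun setT f.
Proof. by move=> /integrableP[/measurable_EFinP]. Qed.

Lemma intgD f g : intg f -> intg g -> intg (fun x => f x + g x).
Proof. by move=> fi gi; apply: (integrableD _ fi gi). Qed.

Lemma intgZ (k : R) f : intg f -> intg (fun x => k * f x).
Proof. by move=> fi; apply: (integrableZl _ k fi). Qed.

Lemma intgN f : intg f -> intg (fun x => - f x).
Proof. by move=> fi; apply: (integrableN fi). Qed.

Lemma intgB f g : intg f -> intg g -> intg (fun x => f x - g x).
Proof. by move=> fi gi; apply: intgD => //; exact: intgN. Qed.

Lemma intg_norm f : intg f -> intg (fun x => `|f x|).
Proof. by move=> fi; apply: (integrable_abse fi). Qed.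

Lemma intg_le f g : measurable_fun setT f -> intg g ->
  (forall x, `|f x| <= `|g x|) -> intg f.
Proof.
move=> mf gi fg; apply: le_integrable gi => //; first exact/measurable_EFinP.
by move=> x _; rewrite /= lee_fin.
Qed.

Lemma intg_ae_le f g : measurable_fun setT f -> intg g ->
  {ae m, forall x, `|f x| <= `|g x|} -> intg f.
Proof.
move=> mf gi fg; apply/integrableP; split; first exact/measurable_EFinP.
have /integrableP[/measurable_EFinP mg] := gi; apply: le_lt_trans.
apply: ae_ge0_le_integral => //.
- by apply/measurable_EFinP; exact: measurableT_comp.
- by apply/measurable_EFinP; exact: measurableT_comp.
- by apply: filterS fg => x fg _; rewrite /= lee_fin.
Qed.

Lemma ae_Rintegral f g : measurable_fun setT f -> measurable_fun setT g ->
  {ae m, forall x, f x = g x} -> \int[m]_x f x = \int[m]_x g x.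
Proof.
move=> mf mg fg; congr fine; apply: ae_eq_integral => //.
- exact/measurable_EFinP.
- exact/measurable_EFinP.
- by apply: filterS fg => x -> _.
Qed.

Lemma ae_le_Rintegral f g : intg f -> intg g ->
  {ae m, forall x, f x <= g x} -> \int[m]_x f x <= \int[m]_x g x.
Proof.
move=> fi gi fg.
have mf := intg_measurable fi; have mg := intg_measurable gi.
rewrite (@ae_Rintegral _ (fun x => Order.min (f x) (g x))) //; last 2 first.
- exact: measurable_minr.
- by apply: filterS fg => x fg; rewrite min_l.
apply: le_Rintegral => //; last by move=> x _; rewrite ge_min lexx orbT.
apply: (@intg_le _ (fun x => `|f x| + `|g x|)).
- exact: measurable_minr.
- by apply: intgD; exact: intg_norm.
- move=> x; rewrite [leRHS]ger0_norm ?addr_ge0//.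
  by case: (leP (f x) (g x)) => _; rewrite ?lerDl ?lerDr.
Qed.

Lemma Rintegral_ae_eq0 f : intg f -> (forall x, 0 <= f x) ->
  \int[m]_x f x = 0 -> {ae m, forall x, f x = 0}.
Proof.
move=> fi f0 I0; have mf := intg_measurable fi.
have : ae_eq m setT (EFin \o f) (cst 0%E).
  apply/ae_eq_integral_abs => //; first exact/measurable_EFinP.
  rewrite (eq_integral (EFin \o f)); last by move=> x _; rewrite /= ger0_norm.
  by rewrite -[LHS]fineK ?[fine _]I0//; exact: integrable_fin_num.
by apply: filterS => x /= /(_ I) [].
Qed.

Lemma intg_ext f g : intg f -> f =1 g -> intg g.
Proof. by move=> fi fg; apply: eq_integrable fi => // x _ /=; rewrite fg. Qed.

Lemma RintegralN f : intg f -> \int[m]_x (- f x) = - \int[m]_x f x.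
Proof.
move=> fi; rewrite -mulN1r -RintegralZl//.
by apply: eq_Rintegral => x _; rewrite mulN1r.
Qed.

End real_integral.

(** * Integration against a mixture of measures *)

Section disintegration.
Context d1 d2 (T1 : measurableType d1) (T2 : measurableType d2) (R : realType).
Context (m : {measure set T1 -> \bar R}) (nu : {measure set T2 -> \bar R}).
Variable K : T1 -> {measure set T2 -> \bar R}.
Hypothesis mK : forall U, measurable U -> measurable_fun setT (K ^~ U).
Hypothesis nuK : forall U, measurable U -> nu U = (\int[m]_z K z U)%E.
Local Open Scope ereal_scope.

Import HBNNSimple.

Let disint_nnsfun (h : {nnsfun T2 >-> R}) :
  \int[nu]_y (h y)%:E = \int[m]_z \int[K z]_y (h y)%:E.
Proof.
have nuE (l : {measure set T2 -> \bar R}) : \int[l]_y (h y)%:E =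
    \sum_(r \in range h) r%:E * l (h @^-1` [set r]).
  by rewrite integralT_nnsfun sintegralE.
rewrite nuE; under [RHS]eq_integral do rewrite nuE.
rewrite ge0_integral_fsum//; last 2 first.
- by move=> r; apply: measurable_funeM; exact: mK.
- by move=> r z _; apply: nnsfun_mulemu_ge0.
apply: eq_fsbigr => r _; have [r0|r0] := leP 0%R r.
  by rewrite ge0_integralZl//; [rewrite nuK//|exact: mK].
rewrite preimage_nnfun0// measure0 mule0.
by rewrite integral0_eq// => z _; rewrite measure0 mule0.
Qed.

(** The hypothesis on sets passes to simple functions by linearity, then to nonnegative functions by
    monotone convergence. [K] is an arbitrary measurable family of measures, so that transition
    kernels and weighted Dirac masses are both covered. *)
Lemma ge0_disintegration (h : T2 -> \bar R) :
  measurable_fun setT h -> (forall y, 0 <= h y) ->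
  \int[nu]_y h y = \int[m]_z \int[K z]_y h y.
Proof.
move=> mh h0; pose h_ := nnsfun_approx measurableT mh.
have nd z : {homo (fun n => (h_ n z)%:E) : a b / (a <= b)%N >-> a <= b}.
  by move=> a b ab; rewrite lee_fin; exact/lefP/nd_nnsfun_approx.
have mh_ n : measurable_fun setT (EFin \o h_ n) by exact/measurable_EFinP.
have hE (l : {measure set T2 -> \bar R}) :
    \int[l]_y h y = limn (fun n => \int[l]_y (h_ n y)%:E).
  rewrite -monotone_convergence//; last by move=> n y _; rewrite lee_fin.
  by apply: eq_integral => y _; apply/esym/cvg_lim => //; exact: cvg_nnsfun_approx.
rewrite hE; under [RHS]eq_integral do rewrite hE.
rewrite monotone_convergence//.
- by congr (lim (_ @ \oo)); apply/funext => n; rewrite disint_nnsfun.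
- move=> k; apply: measurable_fun_integral_kernel => //.
  + by move=> y; rewrite lee_fin.
  + exact: mh_.
- by move=> k z _; apply: integral_ge0 => y _; rewrite lee_fin.
- move=> z _ a b ab; apply: ge0_le_integral => //.
  + by move=> y _; rewrite lee_fin.
  + exact: mh_.
  + exact: mh_.
  + by move=> y _; exact: nd.
Qed.

(** The [K z]-integrals of [|h|] have a finite [m]-integral, so they are finite for almost every
    [z]. This is the source of the almost everywhere qualifications in the rules for [semigroup_op]
    below. *)
Lemma disintegration_integrable (h : T2 -> R) :
    nu.-integrable setT (EFin \o h) ->
  {ae m, forall z, (K z).-integrable setT (EFin \o h)}.
Proof.
move=> /integrableP[mh hoo]; move: hoo.
rewrite ge0_disintegration//; last exact: measurableT_comp.
move=> hoo; have : m.-integrable setT (fun z => \int[K z]_y `|(EFin \o h) y|).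
  apply/integrableP; split.
    by apply: measurable_fun_integral_kernel => //; exact: measurableT_comp.
  apply: le_lt_trans hoo; rewrite le_eqVlt; apply/orP; left; apply/eqP.
  by apply: eq_integral => z _; rewrite gee0_abs// integral_ge0.
move=> /(integrable_ae measurableT); apply: filterS => z /(_ I) /= hz.
apply/integrableP; split => //.
by move: hz; rewrite ge0_fin_numE// integral_ge0.
Qed.

Lemma measurable_disintegration (h : T2 -> R) : measurable_fun setT h ->
  measurable_fun setT (fun z => Rintegral (K z) setT h).
Proof.
move=> mh; apply: measurableT_comp => //.
have mE : measurable_fun setT (EFin \o h) by exact/measurable_EFinP.
under eq_fun do rewrite integralE.
apply: emeasurable_funB; apply: measurable_fun_integral_kernel => //.
- exact: measurable_funepos.
- exact: measurable_funeneg.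
Qed.

Lemma intg_disintegration (h : T2 -> R) : nu.-integrable setT (EFin \o h) ->
  m.-integrable setT (EFin \o (fun z => Rintegral (K z) setT h)).
Proof.
move=> hi; have /integrableP[/measurable_EFinP mh hoo] := hi.
apply/integrableP; split.
  by apply/measurable_EFinP; exact: measurable_disintegration.
apply: le_lt_trans hoo; rewrite ge0_disintegration//; last first.
  by apply/measurable_EFinP; exact: measurableT_comp.
apply: ae_ge0_le_integral => //.
- by apply: measurableT_comp => //; apply/measurable_EFinP; exact: measurable_disintegration.
- by move=> z _; exact: integral_ge0.
- apply: measurable_fun_integral_kernel => //.
  by apply/measurable_EFinP; exact: measurableT_comp.
apply: filterS (disintegration_integrable hi) => z hz _ /=.
rewrite /Rintegral -[(`|_|)%:E]/(`| (fine _)%:E |) fineK; last exact: integrable_fin_num.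
by apply: le_abse_integral => //; exact/measurable_EFinP.
Qed.

Lemma Rintegral_disintegration (h : T2 -> R) :
    nu.-integrable setT (EFin \o h) ->
  Rintegral nu setT h = Rintegral m setT (fun z => Rintegral (K z) setT h).
Proof.
move=> hi; have /integrableP[/measurable_EFinP mh _] := hi.
have mE : measurable_fun setT (EFin \o h) by exact/measurable_EFinP.
congr fine; rewrite integralE.
have hp := integrable_funepos measurableT hi.
have hn := integrable_funeneg measurableT hi.
have mp : measurable_fun setT (fun z => \int[K z]_y (EFin \o h)^\+ y).
  by apply: measurable_fun_integral_kernel => //; exact: measurable_funepos.
have mn : measurable_fun setT (fun z => \int[K z]_y (EFin \o h)^\- y).
  by apply: measurable_fun_integral_kernel => //; exact: measurable_funeneg.
rewrite !ge0_disintegration//; [|exact: measurable_funeneg|exact: measurable_funepos].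
have pi : m.-integrable setT (fun z => \int[K z]_y (EFin \o h)^\+ y).
  apply/integrableP; split => //.
  under eq_integral do rewrite gee0_abs ?integral_ge0//.
  rewrite -ge0_disintegration//; last exact: measurable_funepos.
  exact: integral_funepos_lt_pinfty.
have ni : m.-integrable setT (fun z => \int[K z]_y (EFin \o h)^\- y).
  apply/integrableP; split => //.
  under eq_integral do rewrite gee0_abs ?integral_ge0//.
  rewrite -ge0_disintegration//; last exact: measurable_funeneg.
  exact: integral_funeneg_lt_pinfty.
rewrite -integralB//; apply: ae_eq_integral => //.
- exact: emeasurable_funB.
- by apply/measurable_EFinP; exact: measurable_disintegration.
(* Where [h] is not [K z]-integrable, [fine] may return a default value; such [z] form a null
   set. *)
apply: filterS (disintegration_integrable hi) => z hz _ /=.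
by rewrite /Rintegral fineK; [rewrite -integralE|exact: integrable_fin_num].
Qed.

End disintegration.

(** * Expectations through a density *)

Section density.
Context (R : realType) (d : measure_display) (E : measurableType d).
Context (d' : measure_display) (Om : measurableType d').
Variables (mu : probability E R) (PP : probability Om R).
Variables (X : Om -> E) (f : E -> R).
Hypotheses (mX : measurable_fun setT X) (Xf : is_density mu PP X f).

Let f0 y : 0 <= f y. Proof. by case: Xf. Qed.
Let mf : measurable_fun setT f. Proof. by case: Xf. Qed.

(* [PP] disintegrates over [mu] through the kernel [z |-> f z \d_z]. *)
Lemma ge0_integral_density (h : E -> \bar R) :
  measurable_fun setT h -> (forall y, 0 <= h y)%E ->
  (\int[PP]_w h (X w) = \int[mu]_y ((f y)%:E * h y))%E.
Proof.
move=> mh h0.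
rewrite -[LHS](@ge0_integral_pushforward _ _ _ _ _ _ mX _ setT)//.
rewrite (@ge0_disintegration _ _ _ _ _ mu _
  (fun z => mscale (NngNum (f0 z)) \d_z))//.
- apply: eq_integral => z _.
  by rewrite ge0_integral_mscale// integral_dirac// diracT mul1e.
- move=> U mU; apply: emeasurable_funM; first exact/measurable_EFinP.
  by apply/measurable_EFinP; exact: measurable_indic.
- move=> U mU; rewrite /= /pushforward; case: Xf => _ _ ->//.
  rewrite integral_mkcond; apply: eq_integral => z _.
  rewrite patchE /mscale/= diracE.
  by case: (z \in U); rewrite ?mule1 ?mule0.
Qed.

Lemma intg_densityP (h : E -> R) : measurable_fun setT h ->
  PP.-integrable setT (EFin \o (fun w => h (X w))) <->
  mu.-integrable setT (EFin \o (fun y => f y * h y)).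
Proof.
move=> mh.
have E1 : (\int[PP]_w `|(h (X w))%:E| = \int[mu]_y `|(f y * h y)%:E|)%E.
  rewrite (@ge0_integral_density (fun y => `|(h y)%:E|)%E)//.
  - by apply: eq_integral => y _; rewrite EFinM abseM (gee0_abs (_ : 0 <= (f y)%:E)%E)// lee_fin.
  - by apply: measurableT_comp => //; exact/measurable_EFinP.
split=> /integrableP[_ i]; apply/integrableP; split.
- by apply/measurable_EFinP; exact: measurable_funM.
- by rewrite -E1.
- by apply/measurable_EFinP; exact: measurableT_comp.
- by rewrite E1.
Qed.

Lemma Rintegral_density (h : E -> R) : measurable_fun setT h ->
  mu.-integrable setT (EFin \o (fun y => f y * h y)) ->
  \int[PP]_w h (X w) = \int[mu]_y (f y * h y).
Proof.
move=> mh fhi; have mE : measurable_fun setT (EFin \o h) by exact/measurable_EFinP.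
congr fine; rewrite integralE [RHS]integralE.
congr (_ - _)%E.
- transitivity (\int[mu]_y ((f y)%:E * (EFin \o h)^\+ y))%E.
    rewrite -(@ge0_integral_density ((EFin \o h)^\+)%E)//; last exact: measurable_funepos.
    by apply: eq_integral => w _; rewrite !funeposE.
  by apply: eq_integral => y _; rewrite !funeposE /= EFinM maxe_pMr ?mule0// lee_fin.
- transitivity (\int[mu]_y ((f y)%:E * (EFin \o h)^\- y))%E.
    rewrite -(@ge0_integral_density ((EFin \o h)^\-)%E)//; last exact: measurable_funeneg.
    by apply: eq_integral => w _; rewrite !funenegE.
  by apply: eq_integral => y _; rewrite !funenegE /= -mulrN EFinM maxe_pMr ?mule0// lee_fin.
Qed.

End density.

(** * Square-integrable functions *)

Section square_integrable.
Context d (T : measurableType d) (R : realType) (m : probability T R).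
Implicit Types f g : T -> R.
Local Notation intg f := (m.-integrable setT (EFin \o f)).

Definition sqint f := measurable_fun setT f /\ intg (fun x => f x ^+ 2).

Lemma LfunP2 f : f \in Lfun m 2%:E <-> sqint f.
Proof.
split=> [f2|[mf fi]].
  split; last exact: Lfun2_integrable_sqr.
  by move: f2; rewrite inE => /andP[]; rewrite inE.
rewrite inE; apply/andP; split; rewrite inE//=.
rewrite /finite_norm unlock /=.
rewrite poweR_lty//.
have /integrableP[_] := fi; congr (_ < _)%E; apply: eq_integral => x _ /=.
by rewrite powR_mulrn// normrX.
Qed.

Lemma sqint_cst (c : R) : sqint (cst c).
Proof. by split => //; exact: (finite_measure_integrable_cst _ (c ^+ 2)). Qed.

Lemma intg_cst (c : R) : intg (fun=> c).
Proof. exact: (finite_measure_integrable_cst _ c). Qed.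

Lemma Rint_cst (c : R) : \int[m]_x c = c.
Proof.
rewrite Rintegral_cst//; apply: etrans (mulr1 _); congr (_ * _).
exact: (congr1 fine (probability_setT m)).
Qed.

Lemma sqintM_intg f g : sqint f -> sqint g -> intg (fun x => f x * g x).
Proof.
move=> [mf fi] [mg gi]; apply: (@intg_le _ _ _ _ _ (fun x => f x ^+ 2 + g x ^+ 2)).
- exact: measurable_funM.
- exact: intgD.
- move=> x; rewrite [leRHS]ger0_norm ?addr_ge0 ?sqr_ge0// ler_norml.
  by apply/andP; split; nra.
Qed.

Lemma sqint_intg f : sqint f -> intg f.
Proof.
move=> fi; apply: intg_ext (sqintM_intg (sqint_cst 1) fi) _ => x.
by rewrite /= mul1r.
Qed.

Lemma sqint_le f g : measurable_fun setT f -> sqint g ->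
  (forall x, `|f x| <= `|g x|) -> sqint f.
Proof.
move=> mf [mg gi] fg; split => //; apply: intg_le gi _ => [|x].
  exact: measurable_funX.
by rewrite !normrX lerXn2r ?nnegrE.
Qed.

Lemma sqint_ae_le f g : measurable_fun setT f -> sqint g ->
  {ae m, forall x, `|f x| <= `|g x|} -> sqint f.
Proof.
move=> mf [mg gi] fg; split => //; apply: intg_ae_le gi _.
  exact: measurable_funX.
by apply: filterS fg => x fg; rewrite !normrX lerXn2r ?nnegrE.
Qed.

Lemma sqintZ (k : R) f : sqint f -> sqint (fun x => k * f x).
Proof.
move=> [mf fi]; split; first exact: measurable_funM.
by apply: intg_ext (intgZ (k ^+ 2) fi) _ => x; rewrite exprMn.
Qed.

Lemma sqintD f g : sqint f -> sqint g -> sqint (fun x => f x + g x).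
Proof.
move=> f2 g2; have [[mf fi] [mg gi]] := (f2, g2).
split; first exact: measurable_funD.
apply: intg_ext (intgD (intgD fi gi) (intgZ 2 (sqintM_intg f2 g2))) _ => x /=.
by ring.
Qed.

Lemma sqintN f : sqint f -> sqint (fun x => - f x).
Proof.
by move=> /(sqintZ (-1)); under eq_fun do rewrite mulN1r.
Qed.

Lemma sqintB f g : sqint f -> sqint g -> sqint (fun x => f x - g x).
Proof. by move=> f2 g2; apply: sqintD => //; exact: sqintN. Qed.

Lemma sqint_norm f : sqint f -> sqint (fun x => `|f x|).
Proof.
move=> f2; apply: sqint_le (f2) _ => [|x]; last by rewrite normr_id.
by apply: measurableT_comp => //; case: f2.
Qed.

Definition L2norm f := Num.sqrt (\int[m]_x (f x ^+ 2)).

Lemma sqr_L2norm f : L2norm f ^+ 2 = \int[m]_x (f x ^+ 2).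
Proof. by rewrite sqr_sqrtr// Rintegral_ge0// => x _; exact: sqr_ge0. Qed.

Lemma L2norm_ge0 f : 0 <= L2norm f. Proof. exact: sqrtr_ge0. Qed.

(** The quadratic [k |-> \int (|f| - k |g|)^2] is nonnegative; [F] is its expanded form. *)
Lemma cauchy_schwarz_norm f g : sqint f -> sqint g ->
  \int[m]_x `|f x * g x| <= L2norm f * L2norm g.
Proof.
move=> f2 g2.
have fgi : intg (fun x => `|f x * g x|) by apply: intg_norm; exact: sqintM_intg.
have I0 : 0 <= \int[m]_x `|f x * g x| by apply: Rintegral_ge0.
suff H : (\int[m]_x `|f x * g x|) ^+ 2 <= L2norm f ^+ 2 * L2norm g ^+ 2.
  by rewrite -(@ler_pXn2r _ 2)// ?nnegrE ?mulr_ge0 ?L2norm_ge0// exprMn.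
have F k : 0 <= L2norm f ^+ 2 - 2 * k * (\int[m]_x `|f x * g x|) + k ^+ 2 * L2norm g ^+ 2.
  have fi : intg (fun x => f x ^+ 2) by case: f2.
  have gi : intg (fun x => g x ^+ 2) by case: g2.
  have fgi2 := intgZ (2 * k) fgi; have gi2 := intgZ (k ^+ 2) gi.
  have fB := intgB fi fgi2.
  rewrite !sqr_L2norm -!RintegralZl// -RintegralB// -RintegralD//.
  apply: Rintegral_ge0 => x _; rewrite normrM -[f x ^+ 2]real_normK ?num_real//.
  rewrite -[g x ^+ 2]real_normK ?num_real//.
  by rewrite (_ : _ + _ = (`|f x| - k * `|g x|) ^+ 2) ?sqr_ge0//; ring.
have n2g := L2norm_ge0 g; have n2f := L2norm_ge0 f.
have [g0|gp] := eqVneq (L2norm g) 0.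
  have [->|Ip] := eqVneq (\int[m]_x `|f x * g x|) 0.
    by rewrite expr0n/= mulr_ge0 ?sqr_ge0.
  (* When [g] has norm 0 the quadratic is affine in [k], and at this [k] it equals -1. *)
  have := F ((L2norm f ^+ 2 + 1) / (2 * \int[m]_x `|f x * g x|)).
  rewrite g0 expr0n/= mulr0 addr0.
  rewrite (_ : 2 * _ * _ = L2norm f ^+ 2 + 1); last by field.
  by move=> ?; exfalso; lra.
(* The minimizer of the quadratic. *)
have := F ((\int[m]_x `|f x * g x|) / (L2norm g ^+ 2)).
set J := \int[m]_x _; rewrite (_ : _ + _ = (L2norm f ^+ 2 * L2norm g ^+ 2 - J ^+ 2) / L2norm g ^+ 2); last by field.
by rewrite pmulr_lge0 ?subr_ge0// invr_gt0 exprn_gt0// lt_neqAle eq_sym gp.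
Qed.

Lemma cauchy_schwarz f g : sqint f -> sqint g ->
  `|\int[m]_x (f x * g x)| <= L2norm f * L2norm g.
Proof.
move=> f2 g2; apply: le_trans (cauchy_schwarz_norm f2 g2).
by apply: le_normr_Rintegral => //; exact: sqintM_intg.
Qed.

Lemma le_L2norm f g : measurable_fun setT f -> sqint g ->
  {ae m, forall x, `|f x| <= `|g x|} -> L2norm f <= L2norm g.
Proof.
move=> mf g2 fg; rewrite ler_wsqrtr//; apply: ae_le_Rintegral; last first.
- by apply: filterS fg => x fg; rewrite -(real_normK (num_real (f x))) -(real_normK (num_real (g x))) lerXn2r ?nnegrE.
- by case: g2.
- by case: (sqint_ae_le mf g2 fg).
Qed.

Lemma ae_L2norm f g : measurable_fun setT f -> measurable_fun setT g ->
  {ae m, forall x, f x = g x} -> L2norm f = L2norm g.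
Proof.
move=> mf mg fg; congr Num.sqrt; apply: ae_Rintegral; try exact: measurable_funX.
by apply: filterS fg => x ->.
Qed.

Lemma L2normD f g : sqint f -> sqint g -> L2norm (fun x => f x + g x) <= L2norm f + L2norm g.
Proof.
move=> f2 g2; rewrite -(@ler_pXn2r _ 2)// ?nnegrE ?addr_ge0 ?L2norm_ge0//.
have [[mf fi] [mg gi]] := (f2, g2); have fg := sqintM_intg f2 g2.
rewrite sqr_L2norm (@eq_Rintegral _ _ _ _ _ (fun x => (f x ^+ 2 + g x ^+ 2) + 2 * (f x * g x))); last first.
  by move=> x _; ring.
rewrite RintegralD//; [|exact: intgD|exact: intgZ].
rewrite RintegralD// RintegralZl// -!sqr_L2norm.
have := cauchy_schwarz f2 g2; have := ler_norm (\int[m]_x (f x * g x)).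
by move=> *; nra.
Qed.

Lemma L2normN f : L2norm (fun x => - f x) = L2norm f.
Proof. by congr Num.sqrt; apply: eq_Rintegral => x _; rewrite sqrrN. Qed.

Lemma L2norm_norm f : L2norm (fun x => `|f x|) = L2norm f.
Proof.
by congr Num.sqrt; apply: eq_Rintegral => x _; rewrite real_normK ?num_real.
Qed.

Lemma L2normB f g : sqint f -> sqint g -> L2norm (fun x => f x - g x) <= L2norm f + L2norm g.
Proof. by move=> f2 g2; rewrite -(L2normN g); apply: L2normD => //; exact: sqintN. Qed.

(** Cauchy-Schwarz against the constant 1, of norm 1 since [m] is a probability. *)
Lemma L1_le_L2norm f : sqint f -> \int[m]_x `|f x| <= L2norm f.
Proof.
move=> f2; have := cauchy_schwarz_norm (sqint_cst 1) f2.
rewrite (_ : L2norm (cst 1) = 1).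
  by rewrite mul1r; under eq_Rintegral do rewrite /cst mul1r.
by rewrite /L2norm /= expr1n Rint_cst sqrtr1.
Qed.

End square_integrable.

(** * Weak convergence in L^2 *)

Lemma near_cvg (I : Type) (F : set_system I) {FF : Filter F} (V : topologicalType)
    (f g : I -> V) (l : V) :
  (\forall i \near F, f i = g i) -> f @ F --> l -> g @ F --> l.
Proof. by move=> fg; apply: cvg_trans; exact: near_eq_cvg. Qed.

Lemma measurable_gtr d (T : measurableType d) (R : realType) (f : T -> R) (c : R) :
  measurable_fun setT f -> measurable [set x | c < f x].
Proof.
move=> mf; have := mf measurableT `]c, +oo[%classic (measurable_itv _).
rewrite setTI; congr measurable; apply/seteqP.
by split => x /=; rewrite in_itv/= andbT.
Qed.

Section weak_convergence.
Context d (T : measurableType d) (R : realType) (m : probability T R).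
Implicit Types f g h : T -> R.
Local Notation sqint := (sqint m).
Local Notation L2norm := (L2norm m).

Let clip (k : R) (y : R) : R := Num.max (- k) (Num.min y k).

Let clip_le (k y : R) : 0 <= k -> `|clip k y| <= k.
Proof.
move=> k0; rewrite /clip ler_norml; apply/andP; split.
  by rewrite le_max lexx.
by rewrite ge_max ge_min lexx orbT andbT; lra.
Qed.

Let clip_id k y : `|y| <= k -> clip k y = y.
Proof. by rewrite /clip ler_norml => /andP[? ?]; rewrite min_l// max_r. Qed.

Let clip_err (k y : R) : 0 <= k -> `|y - clip k y| <= `|y|.
Proof.
move=> k0; rewrite /clip; case: (leP y k) => yk.
  by case: (leP (- k) y) => ky; rewrite ?subrr ?normr0// !ler0_norm; lra.
by rewrite max_r ?ger0_norm; lra.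
Qed.

Let measurable_clip k h : measurable_fun setT h ->
  measurable_fun setT (fun x => clip k (h x)).
Proof. by move=> mh; apply: measurable_maxr => //; exact: measurable_minr. Qed.

(** Truncation at level [n] fixes [h x] as soon as [n >= |h x|], and its squared error is dominated
    by [h^2], so dominated convergence applies. *)
Lemma clip_approximation h (e : R) : sqint h -> 0 < e ->
  exists2 K : R, 0 < K & L2norm (fun x => h x - Num.max (- K) (Num.min (h x) K)) < e.
Proof.
move=> h2 e0; have [mh hi] := h2.
pose f_ n x := ((h x - clip n%:R (h x)) ^+ 2)%:E.
have mf_ n : measurable_fun setT (f_ n).
  apply/measurable_EFinP; apply: measurable_funX; apply: measurable_funB => //.
  exact: measurable_clip.
have : (\int[m]_x f_ n x)%E @[n --> \oo] --> (\int[m]_x (cst 0 x))%E.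
  apply: (dominated_cvg measurableT mf_ _ _ hi) => //.
    move=> x _; apply: cvg_near_cst; near=> n.
    rewrite /f_ clip_id ?subrr ?expr0n//.
    near: n; exact: nbhs_infty_ger.
  move=> n x _; rewrite /f_ /= lee_fin normrX.
  by rewrite -(real_normK (num_real (h x))) lerXn2r ?nnegrE// clip_err.
rewrite integral0 => /fine_cvgP[_ /cvgrPdist_lt/(_ (e ^+ 2) (exprn_gt0 _ e0))[N _ H]].
have := H N.+1; rewrite /= leqnSn => /(_ isT).
rewrite sub0r normrN ger0_norm; last by apply: Rintegral_ge0 => x _; exact: sqr_ge0.
move=> lt_e; exists N.+1%:R => //.
by rewrite -(@ltr_pXn2r _ 2)// ?nnegrE ?L2norm_ge0 ?ltW// sqr_L2norm.
Unshelve. all: by end_near. Qed.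

Lemma bounded_approximation h (e : R) : sqint h -> 0 < e ->
  exists (K : R) (hK : T -> R), [/\ 0 < K, measurable_fun setT hK, (forall x, `|hK x| <= K) &
    L2norm (fun x => h x - hK x) < e].
Proof.
move=> h2 e0; have [K K0 he] := clip_approximation h2 e0.
exists K, (fun x => clip K (h x)); split => //.
- by apply: measurable_clip; case: h2.
- by move=> x; apply: clip_le; exact: ltW.
Qed.

Lemma sqint_bounded (k : R) h : measurable_fun setT h ->
  (forall x, `|h x| <= k) -> sqint h.
Proof.
move=> mh hk; apply: sqint_le (sqint_cst _ k) _ => // x.
by apply: le_trans (hk x) _; exact: ler_norm.
Qed.

Lemma sqint_indic (U : set T) : measurable U -> sqint (\1_U).
Proof.
move=> mU; apply: (@sqint_bounded 1) => // x.
by rewrite indicE ger0_norm// lern1 leq_b1.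
Qed.

Context {I : Type} (F : set_system I) {FF : Filter F}.
Implicit Types u v : I -> T -> R.

(** Split [h] into a bounded part, which is paired with the L^1 smallness of [u i], and a remainder
    small in L^2, which is paired with the bound [C]. *)
Lemma weak_cvg0 u h (C : R) : sqint h ->
  (\forall i \near F, sqint (u i) /\ L2norm (u i) <= C) ->
  \int[m]_x `|u i x| @[i --> F] --> 0 ->
  \int[m]_x (h x * u i x) @[i --> F] --> 0.
Proof.
move=> h2 uC u0; apply/cvgr0Pnorm_lt => e e0.
have C1 : 0 < `|C| + 1 by rewrite ltr_wpDl.
have [|K [hK [K0 mhK bhK hKe]]] := @bounded_approximation h (e / 2 / (`|C| + 1)) h2.
  by rewrite !divr_gt0.
have hK2 : sqint hK by exact: sqint_bounded bhK.
have e2K : 0 < e / 2 / K by rewrite !divr_gt0.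
move/cvgr0Pnorm_lt : u0 => /(_ _ e2K) u0.
near=> i.
have [ui2 uiC] : sqint (u i) /\ L2norm (u i) <= C by near: i.
have u0i : `|\int[m]_x `|u i x| | < e / 2 / K by near: i.
have d2 : sqint (fun x => h x - hK x) by exact: sqintB.
have Iu := sqintM_intg d2 ui2; have IK := sqintM_intg hK2 ui2.
have Inu := intg_norm (sqint_intg ui2).
rewrite (@eq_Rintegral _ _ _ _ _ (fun x => (h x - hK x) * u i x + hK x * u i x)); last first.
  by move=> x _; ring.
rewrite RintegralD//; apply: (le_lt_trans (ler_normD _ _)).
rewrite (splitr e); apply: ltr_leD.
  apply: le_lt_trans (cauchy_schwarz d2 ui2) _.
  apply: (@le_lt_trans _ _ (L2norm (fun x => h x - hK x) * (`|C| + 1))).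
    apply: ler_wpM2l; first exact: L2norm_ge0.
    by apply: le_trans uiC _; apply: le_trans (ler_norm _) _; rewrite lerDl.
  by rewrite -ltr_pdivlMr.
apply: le_trans (le_normr_Rintegral measurableT IK) _.
apply: (@le_trans _ _ (\int[m]_x (K * `|u i x|))).
  apply: le_Rintegral => //; [exact: intg_norm|exact: intgZ|move=> x _].
  by rewrite normrM ler_wpM2r.
rewrite RintegralZl// mulrC -ler_pdivlMr// ltW// (le_lt_trans _ u0i)//.
exact: ler_norm.
Unshelve. all: by end_near. Qed.

Lemma L2norm_cvg_ip0 a (a_ : I -> T -> R) u (C : R) : sqint a ->
  (\forall i \near F, sqint (a_ i)) ->
  L2norm (fun x => a_ i x - a x) @[i --> F] --> 0 ->
  (\forall i \near F, sqint (u i) /\ L2norm (u i) <= C) ->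
  \int[m]_x ((a_ i x - a x) * u i x) @[i --> F] --> 0.
Proof.
move=> a2 a_2 aa uC; apply: norm_cvg0.
have aC : L2norm (fun x => a_ i x - a x) * C @[i --> F] --> 0.
  by rewrite -(mul0r C); apply: cvgMl.
apply: (squeeze_cvgr _ (cvg_cst 0) aC).
near=> i; rewrite normr_ge0/=.
have [ui2 uiC] : sqint (u i) /\ L2norm (u i) <= C by near: i.
have d2 : sqint (fun x => a_ i x - a x) by apply: sqintB => //; near: i.
by apply: le_trans (cauchy_schwarz d2 ui2) _; rewrite ler_wpM2l ?L2norm_ge0.
Unshelve. all: by end_near. Qed.

(** The factor [a_ i] is replaced by its strong limit [a] at a cost controlled by [C], and [a] is
    then a fixed test function. This disposes of the second-order terms in difference quotients of
    products. *)
Lemma strong_weak_cvg0 a (a_ : I -> T -> R) u (C : R) : sqint a ->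
  (\forall i \near F, sqint (a_ i)) ->
  L2norm (fun x => a_ i x - a x) @[i --> F] --> 0 ->
  (\forall i \near F, sqint (u i) /\ L2norm (u i) <= C) ->
  \int[m]_x `|u i x| @[i --> F] --> 0 ->
  \int[m]_x (a_ i x * u i x) @[i --> F] --> 0.
Proof.
move=> a2 a_2 aa uC u0.
rewrite -(addr0 0).
apply: (near_cvg _ (cvgD (L2norm_cvg_ip0 a2 a_2 aa uC) (weak_cvg0 a2 uC u0))).
near=> i.
have [ui2 _] : sqint (u i) /\ L2norm (u i) <= C by near: i.
have d2 : sqint (fun x => a_ i x - a x) by apply: sqintB => //; near: i.
rewrite fctE -RintegralD//; try exact: sqintM_intg.
by apply: eq_Rintegral => x _; ring.
Unshelve. all: by end_near. Qed.

Lemma L2norm_cvg_ip a (a_ : I -> T -> R) h : sqint a -> sqint h ->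
  (\forall i \near F, sqint (a_ i)) ->
  L2norm (fun x => a_ i x - a x) @[i --> F] --> 0 ->
  \int[m]_x (a_ i x * h x) @[i --> F] --> \int[m]_x (a x * h x).
Proof.
move=> a2 h2 a_2 aa.
have hC : \forall i \near F, sqint h /\ L2norm h <= L2norm h by near=> i.
rewrite -[X in _ --> X]add0r.
apply: (near_cvg _ (cvgD (L2norm_cvg_ip0 a2 a_2 aa hC) (cvg_cst _))).
near=> i.
have d2 : sqint (fun x => a_ i x - a x) by apply: sqintB => //; near: i.
rewrite fctE -RintegralD//; try exact: sqintM_intg.
by apply: eq_Rintegral => x _; ring.
Unshelve. all: by end_near. Qed.

(* [|u| <= e + c u^2 + 1{|u| > e} / c], by AM-GM where [|u| > e]. *)
Lemma measure_cvg_L1 u (C : R) :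
  (\forall i \near F, sqint (u i) /\ L2norm (u i) <= C) ->
  (forall e, 0 < e ->
    fine (m [set x | e < `|u i x|]) @[i --> F] --> (0 : R)) ->
  \int[m]_x `|u i x| @[i --> F] --> 0.
Proof.
move=> uC u0; apply/cvgr0Pnorm_lt => e e0.
have C1 : 0 < `|C| + 1 by rewrite ltr_wpDl.
(* With this [c] the term in [c u^2] contributes at most [e / 4]; the measure of [{|u| > e / 4}] is
   then taken below [c e / 4], so the three terms add up to less than [e]. *)
pose c := e / 4 / (`|C| + 1) ^+ 2.
have c0 : 0 < c by rewrite !divr_gt0// exprn_gt0.
have e4 : 0 < e / 4 by rewrite divr_gt0.
have e4c : 0 < e / 4 * c by rewrite mulr_gt0.
move/cvgr0Pnorm_lt : (u0 _ e4) => /(_ _ e4c) {}u0.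
near=> i.
have [ui2 uiC] : sqint (u i) /\ L2norm (u i) <= C by near: i.
have u0i : `|fine (m [set x | e / 4 < `|u i x|])| < e / 4 * c by near: i.
set A := [set x | e / 4 < `|u i x|] in u0i *.
have mA : measurable A.
  by apply: measurable_gtr; apply: measurableT_comp => //; case: ui2.
have mAoo : (m A < +oo)%E by rewrite (le_lt_trans (probability_le1 m mA))// ltry.
have I1 : m.-integrable setT (EFin \o (\1_A : T -> R)) by exact: integrable_indic.
have Iu2 : m.-integrable setT (EFin \o (fun x => u i x ^+ 2)) by case: ui2.
have Ie := intg_cst m (e / 4).
have D1 := intgD Ie (intgZ c Iu2); have Z1 := intgZ c^-1 I1.
rewrite ger0_norm ?Rintegral_ge0//.
apply: (@le_lt_trans _ _ (\int[m]_x ((e / 4 + c * u i x ^+ 2) + c^-1 * \1_A x))).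
  apply: le_Rintegral => //; first exact: intg_norm (sqint_intg ui2).
    exact: intgD.
  move=> x _; rewrite indicE; have [xA|xA] := boolP (x \in A).
    rewrite mulr1 -(real_normK (num_real (u i x))).
    set y := `|u i x|; have y0 : 0 <= y by exact: normr_ge0.
    have : 0 <= (c * y - 1) ^+ 2 / c by rewrite divr_ge0 ?sqr_ge0// ltW.
    rewrite (_ : _ / c = c * y ^+ 2 + c^-1 - 2 * y); last by field; rewrite gt_eqF.
    by lra.
  rewrite mulr0 addr0; have : `|u i x| <= e / 4.
    by rewrite leNgt; apply/negP => h; move: xA; rewrite notin_setE => xA; exact: xA.
  have : 0 <= c * u i x ^+ 2 by rewrite mulr_ge0 ?sqr_ge0// ltW.
  lra.
have I2 : \int[m]_x \1_A x = fine (m A).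
  by rewrite /Rintegral integral_indic// setIT.
have Z2 := intgZ c Iu2.
rewrite RintegralD// RintegralD//.
rewrite Rint_cst !RintegralZl// I2 -sqr_L2norm.
have h1 : c * L2norm (u i) ^+ 2 <= e / 4.
  rewrite /c -mulrA ger_pMr// mulrC ler_pdivrMr ?exprn_gt0// mul1r.
  rewrite lerXn2r ?nnegrE ?L2norm_ge0 ?ltW//.
  by apply: (le_lt_trans uiC); apply: le_lt_trans (ler_norm _) _; rewrite ltrDl.
have h2 : c^-1 * fine (m A) < e / 4.
  by rewrite mulrC ltr_pdivrMr// (le_lt_trans _ u0i)// ler_norm.
lra.
Unshelve. all: by end_near. Qed.

End weak_convergence.

(** * Symmetric Markov semigroups *)

Section probability_inequalities.
Context d (T : measurableType d) (R : realType) (m : probability T R).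
Implicit Types f : T -> R.
Local Notation intg f := (m.-integrable setT (EFin \o f)).

Lemma sqr_Rintegral_le f : sqint m f -> (\int[m]_x f x) ^+ 2 <= \int[m]_x (f x ^+ 2).
Proof.
move=> f2; set a := \int[m]_x f x; have fi := sqint_intg f2.
have f2i : intg (fun x => f x ^+ 2) by case: f2.
have Z := intgZ (- (2 * a)) fi; have C := intg_cst m (a ^+ 2).
have D := intgD f2i Z.
have : 0 <= \int[m]_x ((f x ^+ 2 + - (2 * a) * f x) + a ^+ 2).
  apply: Rintegral_ge0 => x _.
  by rewrite (_ : _ + _ = (f x - a) ^+ 2) ?sqr_ge0//; ring.
rewrite RintegralD// RintegralD// Rint_cst RintegralZl// -/a.
by set b := \int[m]_x _; move=> ?; nra.
Qed.

Lemma ln_le_tangent (a z : R) : 0 < a -> 0 < z -> ln z <= ln a + (z - a) / a.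
Proof.
move=> a0 z0; have az : 0 < z / a by rewrite divr_gt0.
have h : -1 < z / a - 1 by lra.
have := le_ln1Dx h; rewrite [1 + _]addrC subrK ln_div ?posrE//.
by rewrite mulrBl divff ?gt_eqF//; lra.
Qed.

(** The tangent to [ln] at the mean of [f] lies above [ln], and its integral is the value of [ln] at
    that mean. *)
Lemma Rintegral_ln_le f : intg f -> intg (fun x => ln (f x)) ->
  {ae m, forall x, 0 < f x} -> 0 < \int[m]_x f x ->
  \int[m]_x ln (f x) <= ln (\int[m]_x f x).
Proof.
move=> fi lfi f0; set a := \int[m]_x f x => a0.
have C := intg_cst m (ln a - 1); have Z := intgZ a^-1 fi.
apply: (@le_trans _ _ (\int[m]_x ((ln a - 1) + a^-1 * f x))).
  apply: ae_le_Rintegral => //; first exact: intgD.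
  apply: filterS f0 => x f0; apply: (le_trans (ln_le_tangent a0 f0)).
  by rewrite mulrBl divff ?gt_eqF// [f x / a]mulrC; lra.
by rewrite RintegralD// Rint_cst RintegralZl// mulVf ?gt_eqF// subrK.
Qed.

End probability_inequalities.

(** * Action of the kernels on functions *)

Section semigroup.
Context (R : realType) (d : measure_display) (E : measurableType d).
Variables (mu : probability E R) (P : R -> R.-pker E ~> E).
Hypothesis SP : symmetric_markov_semigroup mu P.
Implicit Types (f g h : E -> R) (r s t k : R).
Local Notation intg f := (mu.-integrable setT (EFin \o f)).
Local Notation op := (semigroup_op P).
Local Notation sqint := (sqint mu).
Local Notation L2norm := (L2norm mu).

Lemma measurable_ker (t : R) (U : set E) : measurable U ->
  measurable_fun setT (fun y => P t y U).
Proof. by move=> mU; exact: measurable_kernel. Qed.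

Lemma measurable_op t f : measurable_fun setT f -> measurable_fun setT (op t f).
Proof.
move=> mf; apply: measurable_disintegration mf => U mU; exact: measurable_ker.
Qed.

Lemma sqint_op t f : 0 <= t -> sqint f -> sqint (op t f).
Proof.
move=> t0 /LfunP2 f2; apply/LfunP2.
by case: SP => _ _ H _ _; exact: H.
Qed.

Lemma op_sym t f g : 0 <= t -> sqint f -> sqint g ->
  \int[mu]_y (op t f y * g y) = \int[mu]_y (f y * op t g y).
Proof. by move=> t0 /LfunP2 ? /LfunP2 ?; case: SP => _ _ _ H _; exact: H. Qed.

(** Each [P t y] is packaged as a probability measure, so that the inequalities above apply under
    the kernel, point by point. *)
Let kerP t y : set E -> \bar R := P t y.
HB.instance Definition _ t y := Measure.on (kerP t y).
Let kerP1 t y : kerP t y setT = 1%E. Proof. exact: prob_kernel. Qed.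
HB.instance Definition _ t y :=
  Measure_isProbability.Build _ _ _ (kerP t y) (kerP1 t y).
Let pker t y : probability E R := kerP t y.

Lemma op_cst t (c : R) : op t (fun=> c) = fun=> c.
Proof. by apply/funext => y; exact: (Rint_cst (pker t y)). Qed.

(** Self-adjointness tested on the indicator of [U] and the constant 1, which the semigroup fixes.
    With this, [mu] disintegrates over itself through [P t]. *)
Lemma invariant_measure t (U : set E) : 0 <= t -> measurable U ->
  mu U = (\int[mu]_z P t z U)%E.
Proof.
move=> t0 mU; have := op_sym t0 (sqint_indic mu mU) (sqint_cst mu 1).
rewrite (op_cst t 1) /cst.
under eq_Rintegral do rewrite mulr1.
under [in RHS]eq_Rintegral do rewrite mulr1.
rewrite /op /Rintegral.
under eq_integral do rewrite integral_indic// setIT.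
rewrite integral_indic// setIT => H.
have fin (m : probability E R) : m U \is a fin_num by exact: fin_num_measure.
transitivity ((fine (mu U))%:E); first by rewrite fineK.
rewrite -H fineK.
  by apply: eq_integral => z _; rewrite fineK// (fin (pker t z)).
apply: integrable_fin_num => //; apply/integrableP; split.
  by apply/measurable_EFinP; apply: measurableT_comp => //; exact: measurable_ker.
apply: (@le_lt_trans _ _ (\int[mu]_z 1)%E).
  apply: ge0_le_integral => //.
  - by apply: measurableT_comp => //; apply/measurable_EFinP; apply: measurableT_comp => //; exact: measurable_ker.
  - by move=> z _; rewrite /= ger0_norm ?fine_ge0// fineK ?(fin (pker t z))// (probability_le1 (pker t z)).
by rewrite integral_cst// mul1e [X in (X < _)%E](probability_setT mu) ltry.
Qed.

Let mker t U : measurable U -> measurable_fun setT (fun y => P t y U).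
Proof. exact: measurable_ker. Qed.

Lemma op_ae_intg t f : 0 <= t -> intg f ->
  {ae mu, forall y, (P t y).-integrable setT (EFin \o f)}.
Proof.
move=> t0; apply: disintegration_integrable; first exact: mker.
by move=> U; exact: invariant_measure.
Qed.

Lemma intg_op t f : 0 <= t -> intg f -> intg (op t f).
Proof.
move=> t0; apply: intg_disintegration; first exact: mker.
by move=> U; exact: invariant_measure.
Qed.

Lemma Rintegral_op t f : 0 <= t -> intg f ->
  \int[mu]_y op t f y = \int[mu]_y f y.
Proof.
move=> t0 fi; apply/esym; apply: Rintegral_disintegration => //.
  exact: mker.
by move=> U; exact: invariant_measure.
Qed.

(** By invariance the nonnegative function [P t y N] of [y] has mean [mu N]; for a null set [N] it
    vanishes almost everywhere. *)
Lemma op_ae t (A : set E) : 0 <= t -> {ae mu, forall y, A y} ->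
  {ae mu, forall y, {ae P t y, forall z, A z}}.
Proof.
move=> t0 [N [mN N0 AN]].
have : (\int[mu]_y P t y N = 0)%E by rewrite -invariant_measure.
move=> I0; have : ae_eq mu setT (fun y => P t y N) (cst 0%E).
  apply/ae_eq_integral_abs => //; first exact: mker.
  by rewrite -[RHS]I0; apply: eq_integral => y _; rewrite gee0_abs.
by apply: filterS => y /(_ I) yN; exists N.
Qed.

Lemma op_ae_eq t f g : 0 <= t -> measurable_fun setT f -> measurable_fun setT g ->
  {ae mu, forall y, f y = g y} -> {ae mu, forall y, op t f y = op t g y}.
Proof.
move=> t0 mf mg /(op_ae t0); apply: filterS => y fg.
exact: ae_Rintegral.
Qed.

Lemma opB t f g : 0 <= t -> intg f -> intg g ->
  {ae mu, forall y, op t (fun z => f z - g z) y = op t f y - op t g y}.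
Proof.
move=> t0 fi gi; apply: filterS2 (op_ae_intg t0 fi) (op_ae_intg t0 gi) => y ? ?.
exact: RintegralB.
Qed.

Lemma opZ t k f : 0 <= t -> intg f ->
  {ae mu, forall y, op t (fun z => k * f z) y = k * op t f y}.
Proof.
move=> t0 fi; apply: filterS (op_ae_intg t0 fi) => y ?.
exact: RintegralZl.
Qed.

Lemma op_sqr_le t f : 0 <= t -> sqint f ->
  {ae mu, forall y, (op t f y) ^+ 2 <= op t (fun z => f z ^+ 2) y}.
Proof.
move=> t0 [mf fi]; apply: filterS (op_ae_intg t0 fi) => y fy.
exact: (@sqr_Rintegral_le _ _ _ (pker t y)).
Qed.

Lemma op_ln_le t f : 0 <= t -> intg f -> intg (fun y => ln (f y)) ->
  {ae mu, forall y, 0 < f y} -> {ae mu, forall y, 0 < op t f y} ->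
  {ae mu, forall y, op t (fun z => ln (f z)) y <= ln (op t f y)}.
Proof.
move=> t0 fi lfi f0 Pf0; have H := op_ae t0 f0.
apply: filterS3 (filterI (op_ae_intg t0 fi) (op_ae_intg t0 lfi)) H Pf0 => y [? ?] ? ?.
exact: (@Rintegral_ln_le _ _ _ (pker t y)).
Qed.

(** Jensen's inequality under each kernel, then invariance of [mu]. *)
Lemma L2norm_op_le t f : 0 <= t -> sqint f -> L2norm (op t f) <= L2norm f.
Proof.
move=> t0 f2; have [mf fi] := f2.
rewrite /L2norm -(Rintegral_op t0 fi) ler_wsqrtr//; apply: ae_le_Rintegral.
- by case: (sqint_op t0 f2).
- exact: intg_op.
- exact: op_sqr_le.
Qed.

Lemma opK s t f : 0 <= s -> 0 <= t -> intg f ->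
  {ae mu, forall y, op s (op t f) y = op (s + t) f y}.
Proof.
move=> s0 t0 fi; have st0 : 0 <= s + t by rewrite addr_ge0.
apply: filterS (op_ae_intg st0 fi) => y fy.
apply/esym/Rintegral_disintegration => //; first exact: mker.
by move=> U mU; case: SP => _ H _ _ _; exact: H.
Qed.

Lemma op0 f : measurable_fun setT f -> op 0 f = f.
Proof.
move=> mf; apply/funext => y.
rewrite /op /Rintegral (eq_measure_integral (\d_y : {measure set E -> \bar R}))//; last first.
  by move=> A mA _; case: SP => H _ _ _ _; exact: H.
by rewrite integral_dirac//; [rewrite diracT mul1e|exact/measurable_EFinP].
Qed.

End semigroup.

(** * The generator and its symmetry *)

Section generator.
Context (R : realType) (d : measure_display) (E : measurableType d).
Variables (mu : probability E R) (P : R -> R.-pker E ~> E).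
Hypothesis SP : symmetric_markov_semigroup mu P.
Implicit Types (f g h : E -> R) (r s t : R).
Local Notation intg f := (mu.-integrable setT (EFin \o f)).
Local Notation op := (semigroup_op P).
Local Notation sqint := (sqint mu).
Local Notation L2norm := (L2norm mu).

Lemma Lnorm_L2norm f : sqint f -> 'N[mu]_2%:E[EFin \o f]%E = (L2norm f)%:E.
Proof.
move=> [mf fi]; rewrite unlock /=.
have -> : (\int[mu]_x `|(f x)%:E| `^ 2 = (\int[mu]_x (f x ^+ 2))%:E)%E.
  rewrite /Rintegral fineK; last exact: (integrable_fin_num _ fi).
  by apply: eq_integral => x _ /=; rewrite powR_mulrn// real_normK ?num_real.
by rewrite poweR_EFin powR12_sqrt// Rintegral_ge0// => x _; exact: sqr_ge0.
Qed.

Lemma cvg_Lnorm_L2norm (F : R -> E -> R) : (\forall t \near 0^'+, sqint (F t)) ->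
  'N[mu]_2%:E[EFin \o F t]%E @[t --> (0:R)^'+] --> (0 : \bar R) <->
  L2norm (F t) @[t --> (0:R)^'+] --> 0.
Proof.
move=> F2; split => H.
- have /fine_cvgP[_] := H; apply: near_cvg.
  by near=> t; rewrite /= Lnorm_L2norm//; near: t.
- apply/fine_cvgP; split.
    by near=> t; rewrite Lnorm_L2norm//; near: t.
  by apply: near_cvg H; near=> t; rewrite /= Lnorm_L2norm//; near: t.
Unshelve. all: by end_near. Qed.

Lemma op_cvg0 f : sqint f -> L2norm (fun y => op t f y - f y) @[t --> 0^'+] --> 0.
Proof.
move=> f2; apply/cvg_Lnorm_L2norm.
  by near=> t; apply: sqintB => //; apply: (sqint_op SP).
by case: SP => _ _ _ _; apply; exact/LfunP2.
Unshelve. all: by end_near. Qed.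

(* The distance of [op r f] to [op s f] is at most that of [op `|r - s| f] to
   [f], since [op] is a semigroup of contractions. *)
Lemma op_unif_cvg f e : sqint f -> 0 < e -> exists2 del : R, 0 < del &
  forall r s, 0 <= r -> 0 <= s -> `|r - s| < del ->
  L2norm (fun y => op r f y - op s f y) < e.
Proof.
move=> f2 e0; have [mf _] := f2; have fi := sqint_intg f2.
have /cvgr0Pnorm_lt/(_ _ e0)[del /= del0 H] := op_cvg0 f2.
exists del => //.
have main r s : 0 <= s -> s < r -> r - s < del -> L2norm (fun y => op r f y - op s f y) < e.
  move=> s0 sr rs; have rs0 : 0 < r - s by rewrite subr_gt0.
  have rs2 := sqint_op SP (ltW rs0) f2.
  have -> : L2norm (fun y => op r f y - op s f y) = L2norm (op s (fun y => op (r - s) f y - f y)).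
    apply: ae_L2norm.
    - by apply: measurable_funB; exact: measurable_op.
    - by apply: measurable_op; apply: measurable_funB => //; case: rs2.
    apply: filterS2 (opK SP s0 (ltW rs0) fi) (opB SP s0 (sqint_intg rs2) fi) => y.
    by rewrite (addrC s) subrK => -> ->.
  apply: le_lt_trans (L2norm_op_le SP s0 (sqintB rs2 f2)) _.
  have := H (r - s); rewrite /ball /= sub0r normrN ger0_norm ?ltW// => /(_ rs rs0).
  by rewrite ger0_norm ?L2norm_ge0.
move=> r s r0 s0; case: (ltgtP r s) => rs.
- rewrite ler0_norm ?subr_le0 ?ltW// opprB => /(main _ _ r0 rs); rewrite -L2normN.
  by under eq_fun do rewrite opprB.
- by rewrite ger0_norm ?subr_ge0 ?ltW// => /(main _ _ s0 rs).
- move=> _; rewrite rs; apply: le_lt_trans e0.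
  rewrite (_ : L2norm _ = 0)// /L2norm.
  by under eq_Rintegral do rewrite subrr expr0n; rewrite Rint_cst sqrtr0.
Qed.

Lemma op_cvg f s : sqint f -> 0 < s ->
  L2norm (fun y => op (k + s) f y - op s f y) @[k --> (0 : R)^'] --> 0.
Proof.
move=> f2 s0; apply/cvgr0Pnorm_lt => e e0.
have [del del0 H] := op_unif_cvg f2 e0.
near=> k; rewrite ger0_norm ?L2norm_ge0//; apply: H; last 1 first.
- by rewrite addrK; near: k; exact: dnbhs0_lt.
- have : `|k| < s by near: k; exact: dnbhs0_lt.
  by rewrite ltr_norml => /andP[? _]; lra.
- exact: ltW.
Unshelve. all: by end_near. Qed.

(** [is_generator_value] restated with the real-valued norm. A relation is handier than [generator],
    which picks an arbitrary representative of the class. *)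
Definition genval f h := [/\ sqint f, sqint h &
  L2norm (fun y => (op t f y - f y) / t - h y) @[t --> (0 : R)^'+] --> 0].

Lemma sqint_quot t f h : 0 <= t -> sqint f -> sqint h ->
  sqint (fun y => (op t f y - f y) / t - h y).
Proof.
move=> t0 f2 h2; apply: sqintB => //.
under eq_fun do rewrite mulrC.
by apply: sqintZ; apply: sqintB => //; exact: sqint_op SP _ _ _ _.
Qed.

Lemma genvalP f h : is_generator_value mu P f h <-> genval f h.
Proof.
split=> -[f2 h2 H]; split; try exact/LfunP2.
- apply/cvg_Lnorm_L2norm => //; near=> t; apply: sqint_quot; first by [].
    exact/LfunP2.
  exact/LfunP2.
- by apply/cvg_Lnorm_L2norm => //; near=> t; exact: sqint_quot.
Unshelve. all: by end_near. Qed.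

Lemma generator_genval f : dom_generator mu P f -> genval f (generator mu P f).
Proof.
move=> [h fh]; apply/genvalP.
by apply: (@xgetPex _ _ [set h | is_generator_value mu P f h]); exists h.
Qed.

Lemma L2norm_eq0 f : sqint f -> L2norm f <= 0 -> {ae mu, forall y, f y = 0}.
Proof.
move=> [mf fi] f0; have : L2norm f = 0 by apply/eqP; rewrite eq_le f0 L2norm_ge0.
move=> /(congr1 (fun x => x ^+ 2)); rewrite sqr_L2norm expr0n/=.
move=> /(Rintegral_ae_eq0 fi (fun x => sqr_ge0 _)); apply: filterS => y /eqP.
by rewrite sqrf_eq0 => /eqP.
Qed.

(** Uniqueness of L^2 limits. It identifies the representative chosen by [generator] with a value
    obtained in another way. *)
Lemma genval_uniq f h k : genval f h -> genval f k -> {ae mu, forall y, h y = k y}.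
Proof.
move=> [f2 h2 fh] [_ k2 fk]; have hk2 := sqintB h2 k2.
suff : {ae mu, forall y, h y - k y = 0} by apply: filterS => y /subr0_eq.
apply: L2norm_eq0 => //.
rewrite -(addr0 0); apply: (cvgr_to_ge (cvgD fh fk)).
near=> t; have t0 : 0 <= t by [].
have A := sqint_quot t0 f2 h2; have B := sqint_quot t0 f2 k2.
rewrite fctE addrC; apply: le_trans (L2normB B A).
rewrite (_ : (fun y => h y - k y) = (fun y => (op t f y - f y) / t - k y
    - ((op t f y - f y) / t - h y)))//.
by apply/funext => y; ring.
Unshelve. all: by end_near. Qed.

Lemma op_quot s t u f h : 0 <= s -> intg u -> intg f -> intg h ->
  {ae mu, forall y, op s (fun z => (u z - f z) / t - h z) y =
                    (op s u y - op s f y) / t - op s h y}.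
Proof.
move=> s0 ui fi hi; have ufi := intgB ui fi.
have Z := intgZ t^-1 ufi.
apply: filterS3 (opB SP s0 Z hi) (opZ SP t^-1 s0 ufi) (opB SP s0 ui fi) => y.
by under [in LHS]eq_fun do rewrite mulrC; move=> -> -> ->; rewrite mulrC.
Qed.

Lemma genval_ae f f' h : sqint f' -> {ae mu, forall y, f y = f' y} ->
  genval f h -> genval f' h.
Proof.
move=> f'2 ff' [f2 h2 H]; split => //.
apply: near_cvg H; near=> t; have t0 : 0 <= t by [].
have [[mf _] [mf' _]] := (f2, f'2).
apply: ae_L2norm; [by case: (sqint_quot t0 f2 h2)|by case: (sqint_quot t0 f'2 h2)|].
by apply: filterS2 ff' (op_ae_eq SP t0 mf mf' ff') => y -> ->.
Unshelve. all: by end_near. Qed.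

Lemma op_op_quot s t f h : 0 <= s -> 0 <= t -> sqint f -> sqint h ->
  {ae mu, forall y, op s (fun z => (op t f z - f z) / t - h z) y =
                    (op (s + t) f y - op s f y) / t - op s h y}.
Proof.
move=> s0 t0 f2 h2; have fi := sqint_intg f2.
have t2 := sqint_intg (sqint_op SP t0 f2).
apply: filterS2 (op_quot t s0 t2 fi (sqint_intg h2)) (opK SP s0 t0 fi) => y -> ->.
by [].
Qed.

(** [op s] commutes with the difference quotients at 0 and is a contraction. *)
Lemma genval_op s f h : 0 <= s -> genval f h -> genval (op s f) (op s h).
Proof.
move=> s0 [f2 h2 H]; have fi := sqint_intg f2.
have sf2 := sqint_op SP s0 f2; have sh2 := sqint_op SP s0 h2; split=> //.
apply: (squeeze_cvgr _ (cvg_cst 0) H); near=> t; have t0 : 0 <= t by [].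
rewrite L2norm_ge0/=; have q2 := sqint_quot t0 f2 h2.
apply: le_trans (L2norm_op_le SP s0 q2); apply: le_L2norm.
- by case: (sqint_quot t0 sf2 sh2).
- exact: sqint_op.
apply: filterS3 (op_op_quot s0 t0 f2 h2) (opK SP t0 s0 fi) (opK SP s0 t0 fi) => y -> -> _.
by rewrite (addrC t).
Unshelve. all: by end_near. Qed.

(** For [k > 0] the quotient at [s] is [op s] of the quotient at 0, and contraction suffices. For
    [k < 0] it is the forward quotient based at [r = k + s], close to [op r h]; uniform continuity
    of the orbit of [h] then replaces [op r h] by [op s h]. *)
Lemma op_derive f h s : 0 < s -> genval f h ->
  L2norm (fun y => (op (k + s) f y - op s f y) / k - op s h y) @[k --> (0 : R)^'] --> 0.
Proof.
move=> s0 [f2 h2 H]; apply/cvgr0Pnorm_lt => e e0.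
have e2 : 0 < e / 2 by rewrite divr_gt0.
have /cvgr0Pnorm_lt/(_ _ e2)[del1 /= del10 H1] := H.
have [del2 del20 H2] := op_unif_cvg h2 e2.
have s0' := ltW s0.
near=> k; rewrite ger0_norm ?L2norm_ge0//.
have k0 : k != 0 by near: k; exact: nbhs_dnbhs_neq.
pose r := k + s; have -> : k + s = r by [].
have kE : k = r - s by rewrite /r addrK.
rewrite kE.
have rs : r != s by rewrite -subr_eq0 -kE.
have ks : `|k| < s by near: k; exact: dnbhs0_lt.
have r0 : 0 < r by move: ks; rewrite ltr_norml /r => /andP[? _]; lra.
have rs1 : `|r - s| < del1 by rewrite -kE; near: k; exact: dnbhs0_lt.
have rs2 : `|r - s| < del2 by rewrite -kE; near: k; exact: dnbhs0_lt.
have mq : measurable_fun setT (fun y => (op r f y - op s f y) / (r - s) - op s h y).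
  apply: measurable_funB; first apply: measurable_funM => //.
    by apply: measurable_funB; apply: measurable_op; case: f2.
  by apply: measurable_op; case: h2.
clearbody r; move=> {k0 kE ks}.
case: (ltgtP r s) rs => // rs _.
- have t0 : 0 < s - r by rewrite subr_gt0.
  have q2 := sqint_quot (ltW t0) f2 h2.
  have rq2 := sqint_op SP (ltW r0) q2.
  have rh2 := sqint_op SP (ltW r0) h2; have sh2 := sqint_op SP s0' h2.
  have d2 := sqintB rh2 sh2.
  apply: (@le_lt_trans _ _ (L2norm (fun y => op r (fun y => (op (s - r) f y - f y) / (s - r) - h y) y +
     (op r h y - op s h y)))).
    apply: le_L2norm; [exact: mq|exact: sqintD|].
    apply: filterS (op_op_quot (ltW r0) (ltW t0) f2 h2) => y ->.
    have -> : r + (s - r) = s by rewrite addrC subrK.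
    rewrite le_eqVlt; apply/orP; left; apply/eqP; congr (`|_|).
    by field; rewrite !subr_eq0 (gt_eqF rs) (lt_eqF rs).
  apply: le_lt_trans (L2normD rq2 d2) _; rewrite (splitr e) ltrD//; last exact: H2 (ltW r0) s0' rs2.
  apply: le_lt_trans (L2norm_op_le SP (ltW r0) q2) _.
  have := H1 (s - r); rewrite /ball /= sub0r normrN -(distrC r) => /(_ rs1 t0).
  by rewrite ger0_norm ?L2norm_ge0.
- have t0 : 0 < r - s by rewrite subr_gt0.
  have q2 := sqint_quot (ltW t0) f2 h2.
  apply: (@le_lt_trans _ _ (L2norm (op s (fun y => (op (r - s) f y - f y) / (r - s) - h y)))).
    apply: le_L2norm; [exact: mq|exact: sqint_op|].
    apply: filterS (op_op_quot s0' (ltW t0) f2 h2) => y ->.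
    by rewrite (addrC s) subrK.
  apply: le_lt_trans (L2norm_op_le SP s0' q2) _.
  have := H1 (r - s); rewrite /ball /= sub0r normrN => /(_ rs1 t0).
  by rewrite ger0_norm ?L2norm_ge0// => /lt_le_trans; apply; lra.
Unshelve. all: by end_near. Qed.

(** The difference quotients are symmetric at each [t > 0], and the identity passes to the limit. *)
Lemma genval_sym f h u v : genval f h -> genval u v ->
  \int[mu]_y (h y * u y) = \int[mu]_y (f y * v y).
Proof.
move=> [f2 h2 fh] [u2 v2 uv].
pose q (g : E -> R) t y := (op t g y - g y) / t.
have q2 g t : 0 <= t -> sqint g -> sqint (q g t).
  move=> t0 g2; rewrite /q; under eq_fun do rewrite mulrC.
  by apply: sqintZ; apply: sqintB => //; exact: (sqint_op SP).
have A : \int[mu]_y (q f t y * u y) @[t --> 0^'+] --> \int[mu]_y (h y * u y).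
  by apply: L2norm_cvg_ip => //; near=> t; exact: q2.
have B : \int[mu]_y (q u t y * f y) @[t --> 0^'+] --> \int[mu]_y (v y * f y).
  by apply: L2norm_cvg_ip => //; near=> t; exact: q2.
transitivity (\int[mu]_y (v y * f y)); last by apply: eq_Rintegral => y _; rewrite mulrC.
apply: (cvg_unique _ A) => //; apply: near_cvg B; near=> t.
have t0 : 0 <= t by [].
have uf := sqintM_intg (sqint_op SP t0 u2) f2; have fu := sqintM_intg (sqint_op SP t0 f2) u2.
have fu' := sqintM_intg f2 u2; have uf' := sqintM_intg u2 f2.
have e (g k : E -> R) : intg (fun y => op t g y * k y) -> intg (fun y => g y * k y) ->
    \int[mu]_y (q g t y * k y) = t^-1 * (\int[mu]_y (op t g y * k y) - \int[mu]_y (g y * k y)).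
  move=> i1 i2; have i3 := intgB i1 i2.
  rewrite -RintegralB// -RintegralZl//; apply: eq_Rintegral => y _.
  by rewrite /q; ring.
rewrite !e// (op_sym SP t0 f2 u2); congr (_ * (_ - _)); apply: eq_Rintegral => y _; exact: mulrC.
Unshelve. all: by end_near. Qed.

(** Symmetry against the constant 1, on which the generator vanishes. *)
Lemma genval_mean0 f h : genval f h -> \int[mu]_y h y = 0.
Proof.
move=> fh; have g1 : genval (cst 1) (cst 0).
  split; [exact: sqint_cst|exact: sqint_cst|].
  apply: near_cvg (cvg_cst 0); near=> t; rewrite /L2norm (op_cst P t 1).
  by under eq_Rintegral do rewrite subrr mul0r subrr expr0n; rewrite Rint_cst sqrtr0.
have := genval_sym fh g1; rewrite /cst.
under eq_Rintegral do rewrite mulr1; move=> ->.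
by under eq_Rintegral do rewrite mulr0; rewrite Rint_cst.
Unshelve. all: by end_near. Qed.

End generator.

(** * The Markov property *)

Section mscale.
Context d (T : measurableType d) (R : realType) (m : {measure set T -> \bar R}).
Implicit Types f : T -> R.

Lemma Rintegral_mscale (c : {nonneg R}) f : m.-integrable setT (EFin \o f) ->
  Rintegral (mscale c m) setT f = c%:num * Rintegral m setT f.
Proof.
move=> fi; have /integrableP[mf foo] := fi.
have fp := integrable_fin_num measurableT (integrable_funepos measurableT fi).
have fn := integrable_fin_num measurableT (integrable_funeneg measurableT fi).
rewrite /Rintegral integralE [in RHS]integralE.
rewrite !ge0_integral_mscale//; [|exact: measurable_funeneg|exact: measurable_funepos].
rewrite -(fineK fp) -(fineK fn) -!EFinM /=.
by rewrite mulrBr.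
Qed.

End mscale.

Section ae_comparison.
Context d (T : measurableType d) (R : realType) (m : probability T R).
Implicit Types u v : T -> R.

(** On the test set [{u > v}] the integrand becomes the positive part of [u - v], whose integral
    must then be 0. *)
Lemma ae_le_indic u v : sqint m u -> sqint m v ->
  (forall U, measurable U -> \int[m]_x (u x * \1_U x) <= \int[m]_x (v x * \1_U x)) ->
  {ae m, forall x, u x <= v x}.
Proof.
move=> u2 v2 uv; have d2 := sqintB u2 v2.
pose U := [set x | 0 < u x - v x].
have mU : measurable U by apply: measurable_gtr; case: d2.
have U2 := sqint_indic m mU.
have di := sqintM_intg d2 U2.
have dE x : (u x - v x) * \1_U x = Num.max (u x - v x) 0.
  rewrite indicE; case: (ltP 0 (u x - v x)) => h.
    by rewrite mem_set// mulr1.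
  by rewrite memNset ?mulr0// /U/=; apply/negP; rewrite -leNgt.
have d0 x : 0 <= (u x - v x) * \1_U x by rewrite dE le_max lexx orbT.
have I0 : \int[m]_x ((u x - v x) * \1_U x) = 0.
  apply/eqP; rewrite eq_le Rintegral_ge0// andbT.
  under eq_Rintegral do rewrite mulrBl.
  by rewrite RintegralB ?subr_le0 ?uv//; exact: sqintM_intg.
apply: filterS (Rintegral_ae_eq0 di d0 I0) => x; rewrite dE => h.
by rewrite -subr_le0 -h le_max lexx.
Qed.

Lemma ae_eq_indic u v : sqint m u -> sqint m v ->
  (forall U, measurable U -> \int[m]_x (u x * \1_U x) = \int[m]_x (v x * \1_U x)) ->
  {ae m, forall x, u x = v x}.
Proof.
move=> u2 v2 uv.
have h1 : {ae m, forall x, u x <= v x}.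
  by apply: ae_le_indic => // U mU; rewrite uv.
have h2 : {ae m, forall x, v x <= u x}.
  by apply: ae_le_indic => // U mU; rewrite uv.
by apply: filterS2 h1 h2 => x ? ?; apply/eqP; rewrite eq_le; apply/andP.
Qed.

End ae_comparison.

(** The pushforward as a bundled measure, of which only the values on sets are retained. *)
Lemma image_measure d1 d2 (T1 : measurableType d1) (T2 : measurableType d2)
    (R : realType) (m : {measure set T1 -> \bar R}) (phi : T1 -> T2) :
  measurable_fun setT phi ->
  exists nu : {measure set T2 -> \bar R}, forall U, nu U = m (phi @^-1` U).
Proof.
move=> mphi; unshelve eexists (pushforward m phi : {measure set T2 -> \bar R}) => //.
Qed.

(** * From events to integrable functions *)

Section markov.
Context (R : realType) (d : measure_display) (E : measurableType d).
Context (d' : measure_display) (Om : measurableType d').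
Variables (PP : probability Om R) (P : R -> R.-pker E ~> E).
Variables (X : R -> Om -> E) (x : E).
Hypothesis MP : markov_process PP X P x.
Implicit Types (r s t : R) (h : E -> R) (A : set Om).
Local Notation op := (semigroup_op P).

Lemma measurable_process t : 0 <= t -> measurable_fun setT (X t).
Proof. by case: MP => H _ _; exact: H. Qed.

Lemma natural_filtration_measurable t A : natural_filtration X t A -> measurable A.
Proof.
apply: smallest_sub; first exact: sigma_algebra_measurable.
move=> B [r /=]; rewrite in_itv/= => /andP[r0 _] [U mU <-].
exact: measurable_process.
Qed.

Lemma natural_filtration_le s t : s <= t ->
  natural_filtration X s `<=` natural_filtration X t.
Proof.
move=> st; apply: sub_sigma_algebra2 => B [r /= rs BX]; exists r => //=.
by move: rs; rewrite !in_itv/= => /andP[-> /= rs]; exact: le_trans st.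
Qed.

Lemma natural_right_filtration s : natural_filtration X s `<=` right_filtration X s.
Proof.
move=> A sA u /=; rewrite in_itv/= andbT => su.
exact: natural_filtration_le (ltW su) _ sA.
Qed.

Lemma natural_filtration_preimage t (U : set E) : 0 <= t -> measurable U ->
  natural_filtration X t (X t @^-1` U).
Proof.
move=> t0 mU; apply: sub_sigma_algebra; exists t; first by rewrite /= in_itv/= t0 lexx.
by exists U => //; rewrite setTI.
Qed.

Lemma right_filtration_measurable s A : right_filtration X s A -> measurable A.
Proof.
move=> /(_ (s + 1)) sA; apply: (@natural_filtration_measurable (s + 1)); apply: sA.
by rewrite /= in_itv/= andbT ltrDl.
Qed.

Lemma right_filtrationT s : right_filtration X s setT.
Proof.
apply: natural_right_filtration; rewrite -(setD0 setT).
by apply: sigma_algebraCD; exact: sigma_algebra0.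
Qed.

Let mker s r : 0 <= r -> forall U, measurable U ->
  measurable_fun setT (fun w => P s (X r w) U).
Proof.
move=> r0 U mU.
exact: measurableT_comp (measurable_kernel (P s) U mU) (measurable_process r0).
Qed.

(** For [A = setT] the Markov property disintegrates the law of [X (r + s)] over [PP] through the
    kernels [P s (X r w)]. *)
Lemma markov_intg r s h : 0 <= r -> 0 <= s -> measurable_fun setT h ->
  PP.-integrable setT (EFin \o (fun w => h (X (r + s) w))) ->
  PP.-integrable setT (EFin \o (fun w => op s h (X r w))) /\
  {ae PP, forall w, (P s (X r w)).-integrable setT (EFin \o h)}.
Proof.
move=> r0 s0 mh hi; have rs0 := addr_ge0 r0 s0; have mX := measurable_process rs0.
have nuK U : measurable U -> pushforward PP (X (r + s)) U = (\int[PP]_w P s (X r w) U)%E.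
  move=> mU; case: MP => _ _ /(_ r s setT U r0 s0 (@right_filtrationT r) mU).
  by rewrite setTI.
have hnu : (pushforward PP (X (r + s))).-integrable setT (EFin \o h).
  by apply: integrable_pushforward => //; exact/measurable_EFinP.
split.
- exact: (intg_disintegration (mker s r0) nuK hnu).
- exact: (disintegration_integrable (mker s r0) nuK hnu).
Qed.

Lemma markov_Rintegral r s A h : 0 <= r -> 0 <= s -> measurable_fun setT h ->
  PP.-integrable setT (EFin \o (fun w => h (X (r + s) w))) ->
  right_filtration X r A ->
  \int[PP]_w (\1_A w * h (X (r + s) w)) = \int[PP]_w (\1_A w * op s h (X r w)).
Proof.
move=> r0 s0 mh hi rA; have rs0 := addr_ge0 r0 s0; have mX := measurable_process rs0.
have mA := right_filtration_measurable rA.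
have A0 w : 0 <= \1_A w :> R by rewrite indicE.
have [nu nuX] := image_measure (mrestr PP mA) mX.
pose K1 w := mscale (NngNum (A0 w)) (\d_(X (r + s) w)).
pose K2 w := mscale (NngNum (A0 w)) (P s (X r w)).
have m1 U : measurable U -> measurable_fun setT (fun w => (\1_A w : R)%:E).
  by move=> mU; apply/measurable_EFinP; exact: measurable_indic.
have mK1 U : measurable U -> measurable_fun setT (fun w => K1 w U).
  move=> mU; apply: emeasurable_funM; first exact: m1 mU.
  by apply: measurableT_comp (measurable_fun_dirac mU) mX.
have mK2 U : measurable U -> measurable_fun setT (fun w => K2 w U).
  by move=> mU; apply: emeasurable_funM; [exact: m1 mU|exact: mker].
have nuE U : measurable U -> nu U = PP (A `&` X (r + s) @^-1` U).
  by move=> mU; rewrite nuX /mrestr setIC.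
have nuK1 U : measurable U -> nu U = (\int[PP]_w K1 w U)%E.
  move=> mU; have mXU : measurable (X (r + s) @^-1` U).
    by rewrite -[X in measurable X]setTI; exact: mX.
  rewrite nuE// -(setIT (_ `&` _)) -integral_indic//; last exact: measurableI.
  apply: eq_integral => w _; rewrite /K1 /mscale /= diracE indicI /=.
  by rewrite EFinM; congr (_ * _)%E.
have nuK2 U : measurable U -> nu U = (\int[PP]_w K2 w U)%E.
  move=> mU; rewrite nuE//; case: MP => _ _ /(_ r s A U r0 s0 rA mU) ->.
  rewrite integral_mkcond; apply: eq_integral => w _.
  rewrite patchE /K2 /mscale/= indicE.
  by case: (w \in A); rewrite ?mul1e ?mul0e.
have mE : measurable_fun setT (EFin \o h) by exact/measurable_EFinP.
have hnu : nu.-integrable setT (EFin \o h).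
  apply/integrableP; split => //.
  rewrite (ge0_disintegration mK1 nuK1)//; last exact: measurableT_comp.
  have /integrableP[_] := hi; apply: le_lt_trans.
  apply: ge0_le_integral => //.
  - by move=> w _; exact: integral_ge0.
  - by apply: measurable_fun_integral_kernel => //; exact: measurableT_comp.
  - by apply: measurableT_comp => //; apply/measurable_EFinP; exact: measurableT_comp.
  move=> w _; rewrite ge0_integral_mscale//; last exact: measurableT_comp.
  rewrite integral_dirac//; last exact: measurableT_comp.
  rewrite diracT mul1e /= -EFinM lee_fin.
  by rewrite ler_piMl// indicE lern1 leq_b1.
have di w : (\d_(X (r + s) w) : {measure set E -> \bar R}).-integrable setT (EFin \o h).
  apply/integrableP; split => //.
  by rewrite integral_dirac//; [rewrite diracT mul1e ltry|exact: measurableT_comp].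
have [_ Pi] := markov_intg r0 s0 mh hi.
transitivity (Rintegral nu setT h).
  rewrite (Rintegral_disintegration mK1 nuK1 hnu); apply: eq_Rintegral => w _.
  rewrite Rintegral_mscale//; congr (_ * _).
  by rewrite /Rintegral integral_dirac// diracT mul1e.
rewrite (Rintegral_disintegration mK2 nuK2 hnu); apply: ae_Rintegral.
- exact: measurable_disintegration mK2 _ mh.
- apply: measurable_funM; first exact: measurable_indic.
  exact: measurableT_comp (measurable_op P s mh) (measurable_process r0).
- by apply: filterS Pi => w Pw; rewrite Rintegral_mscale.
Qed.

End markov.

(** * Derivative of the entropy *)

Section ln_convergence.
Context d (T : measurableType d) (R : realType) (m : probability T R).
Implicit Types u v : T -> R.
Local Notation intg f := (m.-integrable setT (EFin \o f)).

Lemma Rintegral_indic (A : set T) : measurable A -> \int[m]_x \1_A x = fine (m A).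
Proof. by move=> mA; rewrite /Rintegral integral_indic// setIT. Qed.

Lemma intg_indic (A : set T) : measurable A -> intg (\1_A).
Proof. by move=> mA; exact: sqint_intg (sqint_indic m mA). Qed.

(** An integrable bound on the indicator of [|ln a - ln b| > e]. If [b < expR (- K)] the first term
    is at least 1. Otherwise [ln] has bounded slope near [b], so [a] and [b] cannot be close and the
    second term is at least 1. *)
Lemma ln_dist_le (e K a b : R) : 0 < e -> 0 < K -> 0 < a -> 0 < b ->
  e < `|ln a - ln b| ->
  1 <= `|ln b| / K + `|a - b| / Num.min (expR (- K) / 2) (e * expR (- K) / 2).
Proof.
move=> e0 K0 a0 b0; set c := expR (- K); have c0 : 0 < c by exact: expR_gt0.
(* For [b >= c] and [|a - b| <= c'], the first entry keeps [a >= c / 2] and the second makes both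
   tangent bounds at most [e]. *)
set c' := Num.min _ _.
have c'0 : 0 < c' by rewrite lt_min !divr_gt0// mulr_gt0.
have [c'1 c'2] : c' <= c / 2 /\ c' <= e * c / 2.
  by split; rewrite ge_min lexx ?orbT.
have A0 : 0 <= `|ln b| / K by rewrite divr_ge0// ltW.
have B0 : 0 <= `|a - b| / c' by rewrite divr_ge0// ltW.
have [bc|cb] := ltP b c.
  have : ln b < - K by rewrite -(expRK (- K)) ltr_ln ?posrE ?expR_gt0.
  move=> h _; have : 1 <= `|ln b| / K by rewrite ler_pdivlMr// mul1r ltr0_norm; lra.
  lra.
have [ab|ab] := ltP c' (`|a - b|).
  by move=> _; have : 1 <= `|a - b| / c' by [rewrite ler_pdivlMr// mul1r ltW|]; lra.
rewrite ltNge => /negP[]; rewrite ler_norml.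
move: ab; rewrite ler_norml => /andP[h1 h2].
have T1 := ln_le_tangent b0 a0; have T2 := ln_le_tangent a0 b0.
have ca : c / 2 <= a by lra.
have D1 : (a - b) / b <= e by rewrite ler_pdivrMr//; nra.
have D2 : (b - a) / a <= e by rewrite ler_pdivrMr//; nra.
by apply/andP; split; lra.
Qed.

Context {I : Type} (F : set_system I) {FF : Filter F}.

(** [ln] is not uniformly continuous near 0, but integrability of [ln v] makes small values of [v]
    rare. *)
Lemma ln_cvg_measure (u : I -> T -> R) v : sqint m v -> sqint m (fun x => ln (v x)) ->
  {ae m, forall x, 0 < v x} ->
  (\forall i \near F, sqint m (u i) /\ {ae m, forall x, 0 < u i x}) ->
  L2norm m (fun x => u i x - v x) @[i --> F] --> 0 ->
  forall e, 0 < e ->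
  fine (m [set x | e < `|ln (u i x) - ln (v x)|]) @[i --> F] --> (0 : R).
Proof.
move=> v2 lv2 v0 u2 uv e e0; apply/cvgr0Pnorm_lt => z z0.
have N1 : 0 < L2norm m (fun x => ln (v x)) + 1 by rewrite ltr_wpDl// L2norm_ge0.
(* Large enough for [|ln v| / K] to have integral below [z / 2]. *)
pose K := (L2norm m (fun x => ln (v x)) + 1) / (z / 2).
have z20 : 0 < z / 2 by rewrite divr_gt0.
have K0 : 0 < K by rewrite divr_gt0.
pose c := Num.min (expR (- K) / 2) (e * expR (- K) / 2).
have c0 : 0 < c by rewrite lt_min !divr_gt0 ?mulr_gt0 ?expR_gt0.
have cz0 : 0 < z / 2 * c by rewrite mulr_gt0.
move/cvgr0Pnorm_lt : uv => /(_ _ cz0) uv.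
near=> i.
have [ui2 ui0] : sqint m (u i) /\ {ae m, forall x, 0 < u i x} by near: i.
have uvi : `|L2norm m (fun x => u i x - v x)| < z / 2 * c by near: i.
set A := [set x | _].
have [[mu _] [mv _]] := (ui2, v2).
have mA : measurable A.
  apply: measurable_gtr; apply: measurableT_comp => //.
  by apply: measurable_funB; exact: measurableT_comp.
have d2 := sqintB ui2 v2.
have i1 := intgZ K^-1 (intg_norm (sqint_intg lv2)).
have i2 := intgZ c^-1 (intg_norm (sqint_intg d2)).
rewrite -Rintegral_indic// ger0_norm; last by apply: Rintegral_ge0 => x _; rewrite indicE.
apply: (@le_lt_trans _ _ (\int[m]_x (K^-1 * `|ln (v x)| + c^-1 * `|u i x - v x|))).
  apply: ae_le_Rintegral; [exact: intg_indic|exact: intgD|].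
  apply: filterS2 v0 ui0 => x vx ux; rewrite indicE.
  have [xA|_] := boolP (x \in A); last first.
    by rewrite addr_ge0// mulr_ge0// invr_ge0 ltW.
  rewrite ![_^-1 * _]mulrC; apply: ln_dist_le => //.
  by move: xA; rewrite inE.
rewrite RintegralD// !RintegralZl//; try exact: intg_norm (sqint_intg _).
rewrite (splitr z) ltrD//.
  rewrite mulrC ltr_pdivrMr//; apply: le_lt_trans (L1_le_L2norm lv2) _.
  by rewrite /K mulrC divfK ?gt_eqF// ltrDl.
rewrite mulrC ltr_pdivrMr//; apply: le_lt_trans (L1_le_L2norm d2) _.
exact: le_lt_trans (ler_norm _) uvi.
Unshelve. all: by end_near. Qed.

End ln_convergence.

(** * Densities of the diffusion *)

Section diffusion.
Context (R : realType) (d : measure_display) (E : measurableType d).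
Variables (mu : probability E R) (P : R -> R.-pker E ~> E).
Context (d' : measure_display) (Om : measurableType d').
Variables (PP : probability Om R) (X : R -> Om -> E) (x : E) (f : R -> E -> R).
Hypothesis SP : symmetric_markov_semigroup mu P.
Hypothesis XP : nonneg_curved_diffusion mu PP P X x f.
Implicit Types (h : E -> R) (r s t : R).
Local Notation intg f := (mu.-integrable setT (EFin \o f)).
Local Notation op := (semigroup_op P).
Local Notation sqint := (sqint mu).
Local Notation L2norm := (L2norm mu).
Local Notation L := (generator mu P).
Local Notation g t := (fun y => ln (f t y)).

Let MP : markov_process PP X P x. Proof. by case: XP. Qed.

Lemma diff_density t : 0 < t -> is_density mu PP (X t) (f t).
Proof. by case: XP => _ H /H[[]]. Qed.

Lemma diff_gt0 t : 0 < t -> {ae mu, forall y, 0 < f t y}.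
Proof. by case: XP => _ H /H[[]]. Qed.

Lemma diff_genval t : 0 < t -> genval mu P (f t) (L (f t)).
Proof. by case: XP => _ H /H[_ [D _] _ _ _]; exact: generator_genval. Qed.

Lemma diff_ln_genval t : 0 < t -> genval mu P (g t) (L (g t)).
Proof. by case: XP => _ H /H[_ [_ D] _ _ _]; exact: generator_genval. Qed.

Lemma diff_sqr_genval t : 0 < t ->
  genval mu P (fun y => f t y * f t y) (L (f t \* f t)).
Proof. by case: XP => _ H /H[_ _ [D _ _] _ _]; exact: generator_genval D. Qed.

Lemma diff_lnsqr_genval t : 0 < t ->
  genval mu P (fun y => ln (f t y) * ln (f t y)) (L ((@ln R \o f t) \* (@ln R \o f t))).
Proof. by case: XP => _ H /H[_ _ [_ D _] _ _]; exact: generator_genval D. Qed.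

Lemma diff_mul_genval t : 0 < t ->
  genval mu P (fun y => f t y * ln (f t y)) (L (f t \* (@ln R \o f t))).
Proof. by case: XP => _ H /H[_ _ [_ _ D] _ _]; exact: generator_genval D. Qed.

Lemma diff_sqint t : 0 < t -> sqint (f t).
Proof. by move=> /diff_genval[]. Qed.

Lemma diff_ln_sqint t : 0 < t -> sqint (g t).
Proof. by move=> /diff_ln_genval[]. Qed.

Lemma diff_law r s h : 0 < r -> 0 <= s -> measurable_fun setT h ->
  intg (fun y => f (r + s) y * h y) ->
  intg (fun y => f r y * op s h y) /\
  \int[mu]_y (f (r + s) y * h y) = \int[mu]_y (f r y * op s h y).
Proof.
move=> r0 s0 mh hi; have r0' := ltW r0; have rs0 : 0 < r + s by rewrite ltr_wpDr.
have dr := diff_density r0; have drs := diff_density rs0.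
have mr := measurable_process MP r0'; have mrs := measurable_process MP (ltW rs0).
have hi' := (intg_densityP mrs drs mh).2 hi.
have mo := measurable_op P s mh.
have [oi _] := markov_intg MP r0' s0 mh hi'.
have oi' := (intg_densityP mr dr mo).1 oi; split=> //.
rewrite -(Rintegral_density mrs drs mh hi) -(Rintegral_density mr dr mo oi').
have := markov_Rintegral MP r0' s0 mh hi' (@right_filtrationT _ _ _ _ _ X r).
by under eq_Rintegral do rewrite indicT mul1r;
   under [in RHS]eq_Rintegral do rewrite indicT mul1r.
Qed.

(** The Markov property lets [P_s] act on the test function; symmetry moves it onto the density.
    Testing on indicators identifies the two functions up to a null set, which is all that arbitrary
    versions [f r] allow. *)
Lemma diff_semigroup r s : 0 < r -> 0 <= s ->
  {ae mu, forall y, f (r + s) y = op s (f r) y}.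
Proof.
move=> r0 s0; have rs0 : 0 < r + s by rewrite ltr_wpDr.
have fr := diff_sqint r0; have frs := diff_sqint rs0.
apply: ae_eq_indic => //; first exact: sqint_op.
move=> U mU; have U2 := sqint_indic mu mU.
have [_ ->] := diff_law r0 s0 U2.1 (sqintM_intg frs U2).
by rewrite (op_sym SP).
Qed.

Lemma diff_int1 t : 0 < t -> \int[mu]_y f t y = 1.
Proof.
move=> t0; have mt := measurable_process MP (ltW t0).
have := Rintegral_density mt (diff_density t0) (measurable_cst (1 : R)).
rewrite /cst; under [in X in (_ -> _ = X) -> _]eq_Rintegral do rewrite mulr1.
rewrite Rint_cst => <-//.
by apply: intg_ext (sqint_intg (diff_sqint t0)) _ => y; rewrite mulr1.
Qed.

Lemma entropyE t : 0 < t ->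
  entropy PP (X t) (f t) = \int[mu]_y (f t y * ln (f t y)).
Proof.
move=> t0; have mt := measurable_process MP (ltW t0).
have f2 := diff_sqint t0; have g2 := diff_ln_sqint t0.
rewrite -(Rintegral_density mt (diff_density t0) g2.1 (sqintM_intg f2 g2)).
by rewrite /entropy unlock.
Qed.

End diffusion.

(** * Difference quotients of the density and of the entropy *)

Section entropy_derivative.
Context (R : realType) (d : measure_display) (E : measurableType d).
Variables (mu : probability E R) (P : R -> R.-pker E ~> E).
Context (d' : measure_display) (Om : measurableType d').
Variables (PP : probability Om R) (X : R -> Om -> E) (x : E) (f : R -> E -> R).
Hypothesis SP : symmetric_markov_semigroup mu P.
Hypothesis XP : nonneg_curved_diffusion mu PP P X x f.
Implicit Types (h : E -> R) (r s t k : R).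
Local Notation intg f := (mu.-integrable setT (EFin \o f)).
Local Notation op := (semigroup_op P).
Local Notation sqint := (sqint mu).
Local Notation L2norm := (L2norm mu).
Local Notation L := (generator mu P).
Local Notation g t := (fun y => ln (f t y)).

Let f2 t : 0 < t -> sqint (f t). Proof. exact: (diff_sqint SP XP). Qed.
Let g2 t : 0 < t -> sqint (g t). Proof. exact: (diff_ln_sqint SP XP). Qed.

(** Starting from time [t / 2] leaves room for negative [k]: times on both sides of [t] are reached
    from one function. *)
Let half_semigroup t k : 0 < t -> `|k| < t / 2 ->
  {ae mu, forall y, f (k + t) y = op (k + t / 2) (f (t / 2)) y}.
Proof.
move=> t0 kt; have t20 : 0 < t / 2 by rewrite divr_gt0.
have kt0 : 0 <= k + t / 2 by move: kt; rewrite ltr_norml => /andP[? _]; lra.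
have := diff_semigroup SP XP t20 kt0.
by rewrite (_ : t / 2 + (k + t / 2) = k + t)//; field.
Qed.

Let diff_half t : 0 < t -> {ae mu, forall y, f t y = op (t / 2) (f (t / 2)) y}.
Proof.
move=> t0; have := @half_semigroup t 0 t0; rewrite normr0 !add0r; apply.
by rewrite divr_gt0.
Qed.

Lemma diff_cvg t : 0 < t -> L2norm (fun y => f (k + t) y - f t y) @[k --> (0 : R)^'] --> 0.
Proof.
move=> t0; have t20 : 0 < t / 2 by rewrite divr_gt0.
apply: near_cvg (op_cvg SP (f2 t20) t20); near=> k.
have kt : `|k| < t / 2 by near: k; exact: dnbhs0_lt.
have [kt0 kt20] : 0 < k + t /\ 0 < k + t / 2.
  by move: kt; rewrite ltr_norml => /andP[? _]; split; lra.
apply: ae_L2norm.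
- by case: (sqintB (sqint_op SP (ltW kt20) (f2 t20)) (sqint_op SP (ltW t20) (f2 t20))).
- by case: (sqintB (f2 kt0) (f2 t0)).
by apply: filterS2 (half_semigroup t0 kt) (diff_half t0) => y -> ->.
Unshelve. all: by end_near. Qed.

Lemma diff_derive t : 0 < t ->
  L2norm (fun y => (f (k + t) y - f t y) / k - L (f t) y) @[k --> (0 : R)^'] --> 0.
Proof.
move=> t0; have t20 : 0 < t / 2 by rewrite divr_gt0.
have Gh := diff_genval SP XP t20; have Gt := diff_genval SP XP t0.
(* The generator commutes with the semigroup, so the limit given by [op_derive] is the generator at
   [f t]. *)
have LE : {ae mu, forall y, op (t / 2) (L (f (t / 2))) y = L (f t) y}.
  apply: (genval_uniq SP _ Gt).
  apply: (genval_ae SP (f2 t0) _ (genval_op SP (ltW t20) Gh)).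
  by apply: filterS (diff_half t0) => y ->.
apply: near_cvg (op_derive SP t20 Gh); near=> k.
have kt : `|k| < t / 2 by near: k; exact: dnbhs0_lt.
have [kt0 kt20] : 0 < k + t /\ 0 < k + t / 2.
  by move: kt; rewrite ltr_norml => /andP[? _]; split; lra.
have [mo1 mo2] := (sqint_op SP (ltW kt20) (f2 t20), sqint_op SP (ltW t20) (f2 t20)).
have [_ mL1 _] := Gh; have [_ mL2 _] := Gt; have mo3 := sqint_op SP (ltW t20) mL1.
apply: ae_L2norm.
- apply: measurable_funB; last by case: mo3.
  by apply: measurable_funM => //; case: (sqintB mo1 mo2).
- apply: measurable_funB; last by case: mL2.
  by apply: measurable_funM => //; case: (sqintB (f2 kt0) (f2 t0)).
by apply: filterS3 (half_semigroup t0 kt) (diff_half t0) LE => y -> -> ->.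
Unshelve. all: by end_near. Qed.

(* [ln (f r)] lies between [op (r - t / 2) (ln (f (t / 2)))], by Jensen's
   inequality, and [f r = op (r - t / 2) (f (t / 2))]. *)
Lemma diff_ln_bounded t : 0 < t -> exists C : R,
  \forall k \near (0 : R)^', sqint (fun y => ln (f (k + t) y) - ln (f t y)) /\
    L2norm (fun y => ln (f (k + t) y) - ln (f t y)) <= C.
Proof.
move=> t0; have t20 : 0 < t / 2 by rewrite divr_gt0.
exists (L2norm (f (t / 2)) + L2norm (g (t / 2)) + L2norm (g t)); near=> k.
have kt : `|k| < t / 2 by near: k; exact: dnbhs0_lt.
have [kt0 /ltW kt20] : 0 < k + t /\ 0 < k + t / 2.
  by move: kt; rewrite ltr_norml => /andP[? _]; split; lra.
split; first by apply: sqintB; exact: g2.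
apply: le_trans (L2normB (g2 kt0) (g2 t0)) _; rewrite lerD2r.
have o1 := sqint_op SP kt20 (f2 t20); have o2 := sqint_op SP kt20 (g2 t20).
apply: le_trans _ (lerD (L2norm_op_le SP kt20 (f2 t20)) (L2norm_op_le SP kt20 (g2 t20))).
rewrite -(L2norm_norm _ (op _ (f _))) -(L2norm_norm _ (op _ (g _))).
apply: le_trans _ (L2normD (sqint_norm o1) (sqint_norm o2)).
apply: le_L2norm; [by case: (g2 kt0)|exact: sqintD (sqint_norm o1) (sqint_norm o2)|].
have E1 := half_semigroup t0 kt; have F0 := diff_gt0 XP kt0.
have O0 : {ae mu, forall y, 0 < op (k + t / 2) (f (t / 2)) y}.
  by apply: filterS2 E1 F0 => y ->.
apply: filterS3 E1 O0 (op_ln_le SP kt20 (sqint_intg (f2 t20)) (sqint_intg (g2 t20)) (diff_gt0 XP t20) O0) => y ->.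
set a := op _ _ y; set b := op _ _ y => a0 ba.
rewrite [leRHS]ger0_norm ?addr_ge0// ler_norml; apply/andP; split.
  by have := ler_norm (- b); rewrite normrN; have := normr_ge0 a; lra.
have := ln_le_tangent (ltr01 : 0 < 1 :> R) a0; rewrite ln1 divr1.
by have := ler_norm a; have := normr_ge0 b; lra.
Unshelve. all: by end_near. Qed.

(** The L^2 bound upgrades convergence in measure to convergence in L^1. *)
Lemma diff_ln_cvg t : 0 < t ->
  \int[mu]_y `|ln (f (k + t) y) - ln (f t y)| @[k --> (0 : R)^'] --> 0.
Proof.
move=> t0; have [C HC] := diff_ln_bounded t0.
apply: (measure_cvg_L1 HC) => e e0.
apply: (ln_cvg_measure (f2 t0) (g2 t0) (diff_gt0 XP t0)) => //; last exact: diff_cvg.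
near=> k.
have kt0 : 0 < k + t.
  have : `|k| < t by near: k; exact: dnbhs0_lt.
  by rewrite ltr_norml => /andP[? _]; lra.
by split; [exact: f2|exact: (diff_gt0 XP)].
Unshelve. all: by end_near. Qed.

(** The tangent to [u ln u] at [b], of slope [ln b + 1]. The summand [a - b] will integrate to 0,
    densities having mass 1. *)
Lemma xlnx_convex (a b : R) : 0 < a -> 0 < b ->
  ln b * (a - b) + (a - b) <= a * ln a - b * ln b.
Proof.
move=> a0 b0; have := ln_le_tangent a0 b0.
rewrite -(ler_pM2l a0) mulrDr mulrCA divff ?gt_eqF// mulr1.
by lra.
Qed.

Lemma entropy_cvg t : 0 < t ->
  (entropy PP (X (k + t)) (f (k + t)) - entropy PP (X t) (f t)) / k
    @[k --> (0 : R)^'] --> \int[mu]_y (L (f t) y * ln (f t y)).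
Proof.
move=> t0; have [_ L2 _] := diff_genval SP XP t0; have [C HC] := diff_ln_bounded t0.
pose a k y := (f (k + t) y - f t y) / k.
have ae2 : \forall k \near (0 : R)^', sqint (a k).
  near=> k.
  have kt0 : 0 < k + t.
    have : `|k| < t by near: k; exact: dnbhs0_lt.
    by rewrite ltr_norml => /andP[? _]; lra.
  rewrite /a; under eq_fun do rewrite mulrC.
  by apply: sqintZ; apply: sqintB; exact: f2.
have A1 : \int[mu]_y (a k y * ln (f t y)) @[k --> (0 : R)^'] -->
    \int[mu]_y (L (f t) y * ln (f t y)) := L2norm_cvg_ip L2 (g2 t0) ae2 (diff_derive t0).
(* The gap between the two bounds on the quotient of the entropy. *)
have A2 : \int[mu]_y (a k y * (ln (f (k + t) y) - ln (f t y))) @[k --> (0 : R)^'] --> 0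
  := strong_weak_cvg0 L2 ae2 (diff_derive t0) HC (diff_ln_cvg t0).
have A2'' : `|\int[mu]_y (a k y * (ln (f (k + t) y) - ln (f t y)))| @[k --> (0 : R)^'] --> 0.
  by apply/norm_cvg0P; exact: A2.
have A2' : - `|\int[mu]_y (a k y * (ln (f (k + t) y) - ln (f t y)))| @[k --> (0 : R)^'] --> 0.
  by rewrite -[X in _ --> X]oppr0; exact: cvgN A2''.
pose I1 k := \int[mu]_y (a k y * ln (f t y)).
pose I2 k := \int[mu]_y (a k y * (ln (f (k + t) y) - ln (f t y))).
have B1 : I1 k - `|I2 k| @[k --> (0 : R)^'] --> \int[mu]_y (L (f t) y * ln (f t y)).
  by rewrite -[X in _ --> X]addr0; apply: cvgD; [exact: A1|exact: A2'].
have B2 : I1 k + `|I2 k| @[k --> (0 : R)^'] --> \int[mu]_y (L (f t) y * ln (f t y)).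
  by rewrite -[X in _ --> X]addr0; apply: cvgD; [exact: A1|exact: A2''].
apply: (squeeze_cvgr _ B1 B2); near=> k.
have kt0 : 0 < k + t.
  have : `|k| < t by near: k; exact: dnbhs0_lt.
  by rewrite ltr_norml => /andP[? _]; lra.
have k0 : k != 0 by near: k; exact: nbhs_dnbhs_neq.
have ak2 : sqint (a k) by near: k.
have u2 := sqintB (g2 kt0) (g2 t0).
have [ft fk] := (f2 t0, f2 kt0); have [gt gk] := (g2 t0, g2 kt0).
rewrite !(entropyE SP XP)//.
pose Df := fun y => f (k + t) y - f t y.
have D2 : sqint Df := sqintB fk ft.
have ID : \int[mu]_y Df y = 0.
  rewrite /Df RintegralB//; try exact: sqint_intg.
  by rewrite !(diff_int1 SP XP)// subrr.
have H1 := sqintM_intg gt D2; have H2 := sqintM_intg gk D2.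
have e1 := sqintM_intg fk gk; have e2 := sqintM_intg ft gt.
have Di := sqint_intg D2.
pose J := \int[mu]_y (ln (f t y) * Df y); pose J' := \int[mu]_y (ln (f (k + t) y) * Df y).
have lower : J <= \int[mu]_y (f (k + t) y * ln (f (k + t) y)) - \int[mu]_y (f t y * ln (f t y)).
  rewrite /J -RintegralB// -[leLHS]addr0 -ID -RintegralD//.
  apply: ae_le_Rintegral; [exact: intgD|exact: intgB|].
  by apply: filterS2 (diff_gt0 XP kt0) (diff_gt0 XP t0) => y; exact: xlnx_convex.
have upper : \int[mu]_y (f (k + t) y * ln (f (k + t) y)) - \int[mu]_y (f t y * ln (f t y)) <= J'.
  rewrite /J' -RintegralB// -[leRHS]addr0 -ID -RintegralD//.
  apply: ae_le_Rintegral; [exact: intgB|exact: intgD|].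
  apply: filterS2 (diff_gt0 XP kt0) (diff_gt0 XP t0) => y p q.
  by have := xlnx_convex q p; rewrite /Df; lra.
have JE : J = k * I1 k.
  rewrite /J /I1 -RintegralZl//; last exact: sqintM_intg.
  by apply: eq_Rintegral => y _; rewrite /a /Df; field.
have J'E : J' = J + k * I2 k.
  rewrite JE -mulrDr /I1 /I2 -RintegralD//; [|exact: sqintM_intg|exact: sqintM_intg].
  rewrite -RintegralZl//; last by apply: intgD; exact: sqintM_intg.
  by apply: eq_Rintegral => y _; rewrite /a /Df; field.
move: lower upper; rewrite J'E JE; set V := _ - _ => lower upper.
(* Division by a negative [k] would reverse the bounds; from [0 <= V - k * I1 k <= k * I2 k] the
   estimate in absolute value holds for both signs. *)
have hV : `|V / k - I1 k| <= `|I2 k|.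
  rewrite (_ : V / k - I1 k = (V - k * I1 k) / k); last by field.
  rewrite normrM normfV ler_pdivrMr ?normr_gt0// -normrM.
  by rewrite ger0_norm ?subr_ge0//; have := ler_norm (I2 k * k); lra.
by move: hV; rewrite ler_norml => /andP[? ?]; apply/andP; split; lra.
Unshelve. all: by end_near. Qed.

End entropy_derivative.

(** * Local Poincare inequality *)

Section real_limits.
Variable R : realType.

Lemma cvg_oppr_dnbhs0 : (- k) @[k --> (0 : R)^'] --> (0 : R)^'.
Proof.
move=> A [e /= e0 eA]; exists e => //= k /=.
rewrite sub0r normrN => ke k0; apply: eA; last by rewrite oppr_eq0.
by rewrite /ball_ /= sub0r opprK.
Qed.

Lemma cvg_oppr_right0 : (- k) @[k --> (0 : R)^'+] --> (0 : R)^'.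
Proof.
move=> A [e /= e0 eA]; exists e => //= k /=.
rewrite sub0r normrN => ke k0; apply: eA; last by rewrite oppr_eq0 gt_eqF.
by rewrite /ball_ /= sub0r opprK.
Qed.

Lemma slope_is_derive (F : R -> R) (a l : R) :
  (F (k + a) - F a) / k @[k --> (0 : R)^'] --> l -> is_derive a (1 : R) F l.
Proof.
move=> H.
have H' : k^-1 *: ((F \o shift a) (k *: (1 : R)) - F a) @[k --> (0 : R)^'] --> l.
  apply: near_cvg H; near=> k.
  by rewrite /= [k *: 1]mulr1 mulrC.
apply: DeriveDef; first by apply/cvg_ex; exists l.
exact: cvg_lim H'.
Unshelve. all: by end_near. Qed.

End real_limits.

Section local_poincare.
Context (R : realType) (d : measure_display) (E : measurableType d).
Variables (mu : probability E R) (P : R -> R.-pker E ~> E).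
Context (d' : measure_display) (Om : measurableType d').
Variables (PP : probability Om R) (X : R -> Om -> E) (x : E) (f : R -> E -> R).
Hypothesis SP : symmetric_markov_semigroup mu P.
Hypothesis XP : nonneg_curved_diffusion mu PP P X x f.
Implicit Types (h : E -> R) (r s k : R).
Local Notation intg f := (mu.-integrable setT (EFin \o f)).
Local Notation op := (semigroup_op P).
Local Notation sqint := (sqint mu).
Local Notation L2norm := (L2norm mu).
Local Notation L := (generator mu P).
Variable t : R.
Hypothesis t0 : 0 < t.
Local Notation g := (@ln R \o f t).
Local Notation G := (fun s => op s g).
Local Notation Gam := (carre_du_champ mu P).

Let f2 r : 0 < r -> sqint (f r). Proof. exact: (diff_sqint SP XP). Qed.
Let g2 : sqint g. Proof. exact: (diff_ln_sqint SP XP). Qed.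
Let gg2 : sqint (fun y => g y ^+ 2).
Proof.
have [H _ _] := diff_lnsqr_genval SP XP t0.
by under eq_fun do rewrite expr2.
Qed.
Let ff2 r : 0 < r -> sqint (fun y => f r y ^+ 2).
Proof.
move=> r0; have [H _ _] := diff_sqr_genval SP XP r0.
by under eq_fun do rewrite expr2.
Qed.

Let curv : nonneg_curvature mu P g. Proof. by case: XP => _ /(_ _ t0)[]. Qed.

Let G2 s : 0 <= s -> sqint (G s). Proof. by move=> s0; exact: sqint_op. Qed.

Let GG_gen s : 0 <= s -> genval mu P (G s \* G s) (L (G s \* G s)).
Proof. by move=> /curv[_ D _]; exact: generator_genval D. Qed.

Let G_gen s : 0 <= s -> genval mu P (G s) (L (G s)).
Proof. by move=> /curv[D _ _]; exact: generator_genval D. Qed.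

Let GG2 s : 0 <= s -> sqint (fun y => G s y ^+ 2).
Proof.
move=> s0; have [H _ _] := GG_gen s0.
by under eq_fun do rewrite expr2.
Qed.

(** Jensen's inequality bounds [(P_s g)^2] by [P_s (g^2)]; the bound is uniform in [s]. *)
Let GG_bounded s : 0 <= s -> L2norm (fun y => G s y ^+ 2) <= L2norm (fun y => g y ^+ 2).
Proof.
move=> s0; apply: le_trans (L2norm_op_le SP s0 gg2).
apply: le_L2norm; [by case: (GG2 s0)|exact: sqint_op|].
apply: filterS (op_sqr_le SP s0 g2) => y h.
by rewrite !ger0_norm ?sqr_ge0//; exact: le_trans (sqr_ge0 _) h.
Qed.

(** Both factors are in L^4, their squares being in the domain of the generator. *)
Let fG2 r s : 0 < r -> 0 <= s -> sqint (fun y => f r y * G s y).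
Proof.
move=> r0 s0; split; first by apply: measurable_funM; [case: (f2 r0)|case: (G2 s0)].
apply: intg_ext (sqintM_intg (ff2 r0) (GG2 s0)) _ => y.
by rewrite exprMn.
Qed.

Let GG_L1 s s' : 0 <= s -> 0 <= s' ->
  \int[mu]_y `|G s' y ^+ 2 - G s y ^+ 2| <=
  L2norm (fun y => G s' y - G s y) * (2 * L2norm g).
Proof.
move=> s0 s'0; have D := sqintB (G2 s'0) (G2 s0); have S := sqintD (G2 s'0) (G2 s0).
apply: (@le_trans _ _ (L2norm (fun y => G s' y - G s y) * L2norm (fun y => G s' y + G s y))).
  apply: le_trans (cauchy_schwarz_norm D S).
  by under eq_Rintegral do rewrite subr_sqr.
rewrite ler_wpM2l ?L2norm_ge0//; apply: le_trans (L2normD (G2 s'0) (G2 s0)) _.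
by have := L2norm_op_le SP s0 g2; have := L2norm_op_le SP s'0 g2; lra.
Qed.

Definition poincare_interp s := \int[mu]_y (f (t - s) y * G s y ^+ 2).

Let near_in s : 0 < s -> s < t -> \forall k \near (0 : R)^', 0 < k + s /\ 0 < t - (k + s).
Proof.
move=> s0 st; near=> k.
have k1 : `|k| < s by near: k; exact: dnbhs0_lt.
have k2 : `|k| < t - s by near: k; apply: dnbhs0_lt; rewrite subr_gt0.
by move: k1 k2; rewrite !ltr_norml => /andP[? ?] /andP[? ?]; split; lra.
Unshelve. all: by end_near. Qed.

Let G_cvg s : 0 < s -> L2norm (fun y => G (k + s) y - G s y) @[k --> (0 : R)^'] --> 0.
Proof. exact: (op_cvg SP). Qed.

(** [G] is differentiable in L^2 but [G^2] is not known to be. With [D] for increments, that of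
    [f * G^2] is split as [Df * G^2 + Df * D(G^2) + DG * (f * DG) + 2 * DG * (f * G)], with [f] and
    [G] at the base point. The quotients of [Df] and [DG] converge strongly; the second and third
    terms vanish, their other factor being bounded in L^2 and small in L^1. *)
Lemma poincare_interp_slope s : 0 < s -> s < t ->
  (poincare_interp (k + s) - poincare_interp s) / k @[k --> (0 : R)^'] -->
    - (\int[mu]_y (L (f (t - s)) y * G s y ^+ 2)) +
    2 * \int[mu]_y (L (G s) y * (f (t - s) y * G s y)).
Proof.
move=> s0 st; have ts0 : 0 < t - s by rewrite subr_gt0.
have s0' := ltW s0.
have [_ Lf2 _] := diff_genval SP XP ts0; have [_ LG2 _] := G_gen s0'.
have [_ Lg2 _] := diff_ln_genval SP XP t0.
pose b k y := (f (t - (k + s)) y - f (t - s) y) / k.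
pose a k y := (G (k + s) y - G s y) / k.
have b2 : \forall k \near (0 : R)^', sqint (b k).
  apply: filterS (near_in s0 st) => k [_ k0].
  by rewrite /b; under eq_fun do rewrite mulrC; apply: sqintZ; apply: sqintB; exact: f2.
have a2 : \forall k \near (0 : R)^', sqint (a k).
  apply: filterS (near_in s0 st) => k [k0 _].
  by rewrite /a; under eq_fun do rewrite mulrC; apply: sqintZ; apply: sqintB; apply: G2 => //; exact: ltW.
(* Time runs backwards in [f (t - s)], whence the sign and the substitution of [- k] for [k]. *)
have bcvg : L2norm (fun y => b k y - (- L (f (t - s)) y)) @[k --> (0 : R)^'] --> 0.
  apply: near_cvg (cvg_comp _ _ (@cvg_oppr_dnbhs0 R) (diff_derive SP XP ts0)).
  near=> k; rewrite /= -L2normN; congr (L2norm _); apply/funext => y.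
  by rewrite /b (_ : t - (k + s) = - k + (t - s)); [rewrite invrN; ring|ring].
have acvg : L2norm (fun y => a k y - L (G s) y) @[k --> (0 : R)^'] --> 0.
  have Lop := genval_uniq SP (genval_op SP s0' (diff_ln_genval SP XP t0)) (G_gen s0').
  apply: near_cvg (op_derive SP s0 (diff_ln_genval SP XP t0)).
  near=> k; have ak2 : sqint (a k) by near: k.
  apply: ae_L2norm.
  - by apply: measurable_funB; [case: ak2|case: (sqint_op SP s0' Lg2)].
  - by apply: measurable_funB; [case: ak2|case: LG2].
  by apply: filterS Lop => y ->.
have Gcvg := G_cvg s0.
have uC : \forall k \near (0 : R)^',
    sqint (fun y => G (k + s) y ^+ 2 - G s y ^+ 2) /\
    L2norm (fun y => G (k + s) y ^+ 2 - G s y ^+ 2) <= 2 * L2norm (fun y => g y ^+ 2).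
  apply: filterS (near_in s0 st) => k [/ltW k0 _]; split.
    by apply: sqintB; exact: GG2.
  apply: le_trans (L2normB (GG2 k0) (GG2 s0')) _.
  by have := GG_bounded k0; have := GG_bounded s0'; lra.
have uL1 : \int[mu]_y `|G (k + s) y ^+ 2 - G s y ^+ 2| @[k --> (0 : R)^'] --> 0.
  have H : L2norm (fun y => G (k + s) y - G s y) * (2 * L2norm g) @[k --> (0 : R)^'] --> 0.
    by rewrite -[X in _ --> X](mul0r (2 * L2norm g)); apply: cvgMl.
  apply: (squeeze_cvgr _ (cvg_cst 0) H); near=> k.
  rewrite Rintegral_ge0//=; apply: GG_L1 => //; apply: ltW.
  by have [] : 0 < k + s /\ 0 < t - (k + s) by near: k; exact: near_in.
pose v k y := f (t - s) y * G (k + s) y - f (t - s) y * G s y.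
have v2 k : 0 <= k + s -> sqint (v k).
  by move=> k0; apply: sqintB; exact: fG2.
have vC : \forall k \near (0 : R)^', sqint (v k) /\
    L2norm (v k) <= 2 * Num.sqrt (L2norm (fun y => f (t - s) y ^+ 2) * L2norm (fun y => g y ^+ 2)).
  have B r : 0 <= r -> L2norm (fun y => f (t - s) y * G r y) <=
      Num.sqrt (L2norm (fun y => f (t - s) y ^+ 2) * L2norm (fun y => g y ^+ 2)).
    move=> r0; rewrite ler_wsqrtr//.
    under eq_Rintegral do rewrite exprMn.
    apply: le_trans (ler_norm _) _.
    apply: le_trans (cauchy_schwarz (ff2 ts0) (GG2 r0)) _.
    by rewrite ler_wpM2l ?L2norm_ge0// GG_bounded.
  apply: filterS (near_in s0 st) => k [/ltW k0 _]; split; first exact: v2.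
  apply: le_trans (L2normB (fG2 ts0 k0) (fG2 ts0 s0')) _.
  by have := B _ k0; have := B _ s0'; lra.
have vL1 : \int[mu]_y `|v k y| @[k --> (0 : R)^'] --> 0.
  have H : L2norm (f (t - s)) * L2norm (fun y => G (k + s) y - G s y) @[k --> (0 : R)^'] --> 0.
    by rewrite -[X in _ --> X](mulr0 (L2norm (f (t - s)))); apply: cvgMr.
  apply: (squeeze_cvgr _ (cvg_cst 0) H); near=> k.
  have [/ltW k0 _] : 0 < k + s /\ 0 < t - (k + s) by near: k; exact: near_in.
  rewrite Rintegral_ge0//=; apply: le_trans (cauchy_schwarz_norm (f2 ts0) (sqintB (G2 k0) (G2 s0'))).
  by rewrite /v; under eq_Rintegral do rewrite -mulrBr.
have NL2 := sqintN Lf2.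
have T1 : \int[mu]_y (b k y * G s y ^+ 2) @[k --> (0 : R)^'] -->
    \int[mu]_y (- L (f (t - s)) y * G s y ^+ 2) := L2norm_cvg_ip NL2 (GG2 s0') b2 bcvg.
have T2 : \int[mu]_y (b k y * (G (k + s) y ^+ 2 - G s y ^+ 2)) @[k --> (0 : R)^'] --> 0
  := strong_weak_cvg0 NL2 b2 bcvg uC uL1.
have T3 : \int[mu]_y (a k y * v k y) @[k --> (0 : R)^'] --> 0
  := strong_weak_cvg0 LG2 a2 acvg vC vL1.
have fGs := fG2 ts0 s0'.
have T4 : \int[mu]_y (a k y * (f (t - s) y * G s y)) @[k --> (0 : R)^'] -->
    \int[mu]_y (L (G s) y * (f (t - s) y * G s y)) := L2norm_cvg_ip LG2 fGs a2 acvg.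
have NI : \int[mu]_y (- L (f (t - s)) y * G s y ^+ 2) =
    - \int[mu]_y (L (f (t - s)) y * G s y ^+ 2).
  rewrite -RintegralN; last by apply: sqintM_intg => //; exact: GG2.
  by under eq_Rintegral do rewrite mulNr.
rewrite NI in T1.
pose p k := \int[mu]_y (b k y * G s y ^+ 2) +
  \int[mu]_y (b k y * (G (k + s) y ^+ 2 - G s y ^+ 2)).
pose q k := \int[mu]_y (a k y * v k y) + 2 * \int[mu]_y (a k y * (f (t - s) y * G s y)).
have T12 : p k @[k --> (0 : R)^'] --> - \int[mu]_y (L (f (t - s)) y * G s y ^+ 2).
  by rewrite -[X in _ --> X]addr0; apply: cvgD; [exact: T1|exact: T2].
have T34 : q k @[k --> (0 : R)^'] --> 2 * \int[mu]_y (L (G s) y * (f (t - s) y * G s y)).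
  rewrite -[X in _ --> X]add0r; apply: cvgD; first exact: T3.
  by apply: cvgMr; exact: T4.
have T5 : p k + q k @[k --> (0 : R)^'] --> - (\int[mu]_y (L (f (t - s)) y * G s y ^+ 2)) +
    2 * \int[mu]_y (L (G s) y * (f (t - s) y * G s y)).
  exact: (@cvgD _ _ _ _ _ p q _ _ T12 T34).
apply: near_cvg T5; near=> k; rewrite /p /q.
have k0 : k != 0 by near: k; exact: nbhs_dnbhs_neq.
have [/ltW ks0 tks0] : 0 < k + s /\ 0 < t - (k + s) by near: k; exact: near_in.
have bk2 : sqint (b k) by near: k.
have ak2 : sqint (a k) by near: k.
have GGk := GG2 ks0; have GGs := GG2 s0'.
have i1 := sqintM_intg bk2 GGs; have i2 := sqintM_intg bk2 (sqintB GGk GGs).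
have i3 := sqintM_intg ak2 (v2 _ ks0); have i4 := sqintM_intg ak2 fGs.
have i5 := intgD i1 i2; have i6 := intgZ 2 i4; have i7 := intgD i3 i6.
rewrite -RintegralD// -RintegralZl// -RintegralD// -RintegralD//.
have j1 := sqintM_intg (f2 tks0) GGk; have j2 := sqintM_intg (f2 ts0) GGs.
rewrite /poincare_interp -RintegralB// mulrC -RintegralZl//; last exact: intgB.
by apply: eq_Rintegral => y _; rewrite /b /a /v; field.
Unshelve. all: by end_near. Qed.

(** The product [G s * L (G s)] inside [Gam] is only integrable, so the weight is grouped as
    [(f r * G s) * L (G s)], a product of two functions in L^2. *)
Lemma intg_carre r s : 0 < r -> 0 <= s -> intg (fun y => f r y * Gam (G s) (G s) y).
Proof.
move=> r0 s0; have [_ A _] := GG_gen s0; have [_ B _] := G_gen s0.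
have i1 := sqintM_intg (f2 r0) A; have i2 := sqintM_intg (fG2 r0 s0) B.
apply: intg_ext (intgZ 2^-1 (intgB (intgB i1 i2) i2)) _ => y.
by rewrite /carre_du_champ /=; ring.
Qed.

Let G0 : G 0 = g. Proof. by apply: (op0 SP); case: g2. Qed.

Let K := \int[mu]_y (f t y * Gam g g y).

Lemma intg_carre_ln : intg (fun y => f t y * Gam g g y).
Proof. by have := intg_carre t0 (lexx 0); rewrite G0. Qed.

Lemma measurable_carre_ln : measurable_fun setT (Gam g g).
Proof.
have [_ [A _] _] := GG_gen (lexx 0); have [_ [B _] _] := G_gen (lexx 0).
rewrite G0 in A B; have [C _] := g2.
apply: measurable_funM => //; apply: measurable_funB; last exact: measurable_funM.
by apply: measurable_funB => //; exact: measurable_funM.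
Qed.

(** The law at time [t] turns [K] into the integral of [f (t - s) * P_s (Gam g g)], to which the
    curvature bound applies pointwise. *)
Lemma carre_interp_le s : 0 < s -> s < t ->
  \int[mu]_y (f (t - s) y * Gam (G s) (G s) y) <= K.
Proof.
move=> s0 st; have ts0 : 0 < t - s by rewrite subr_gt0.
have := @diff_law _ _ _ _ _ _ _ _ _ _ _ XP (t - s) s (Gam g g) ts0 (ltW s0) measurable_carre_ln.
rewrite subrK => /(_ intg_carre_ln)[i1 E1]; rewrite /K E1.
apply: ae_le_Rintegral => //; first exact: intg_carre ts0 (ltW s0).
have [_ _ H] := curv (ltW s0).
by apply: filterS2 (diff_gt0 XP ts0) H => y fy h; rewrite ler_wpM2l// ltW.
Qed.

(** Symmetry moves [L] from [f (t - s)] to [(G s)^2], and [- L (G^2) + 2 G * L G] is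
    [- 2 Gam G G]. *)
Lemma poincare_slope_ge s : 0 < s -> s < t ->
  - (2 * K) <= - (\int[mu]_y (L (f (t - s)) y * G s y ^+ 2)) +
    2 * \int[mu]_y (L (G s) y * (f (t - s) y * G s y)).
Proof.
move=> s0 st; have ts0 : 0 < t - s by rewrite subr_gt0.
have s0' := ltW s0.
have := carre_interp_le s0 st; set C := \int[mu]_y _ => CK.
suff -> : - (\int[mu]_y (L (f (t - s)) y * G s y ^+ 2)) +
    2 * \int[mu]_y (L (G s) y * (f (t - s) y * G s y)) = - (2 * C) by lra.
have E1 : \int[mu]_y (L (f (t - s)) y * G s y ^+ 2) =
    \int[mu]_y (f (t - s) y * L (G s \* G s) y).
  rewrite -(genval_sym SP (diff_genval SP XP ts0) (GG_gen s0')).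
  by apply: eq_Rintegral => y _; rewrite expr2.
have [_ A _] := GG_gen s0'; have [_ B _] := G_gen s0'.
have i1 := sqintM_intg (f2 ts0) A; have i2 := sqintM_intg B (fG2 ts0 s0').
have i3 := intg_carre ts0 s0'.
rewrite E1 addrC -RintegralZl// -RintegralB//; last exact: intgZ.
rewrite /C -RintegralZl// -RintegralN; last exact: intgZ.
by apply: eq_Rintegral => y _; rewrite /carre_du_champ /=; field.
Qed.

Lemma poincare_interp_cvg0 :
  poincare_interp s @[s --> (0 : R)^'+] --> \int[mu]_y (f t y * g y ^+ 2).
Proof.
have nr : \forall s \near (0 : R)^'+, 0 < s /\ 0 < t - s.
  near=> s; split=> //; rewrite subr_gt0; near: s; exact: nbhs_right_lt.
have fcvg : L2norm (fun y => f (t - s) y - f t y) @[s --> (0 : R)^'+] --> 0.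
  apply: near_cvg (cvg_comp _ _ (@cvg_oppr_right0 R) (diff_cvg SP XP t0)).
  by near=> s; rewrite /= addrC.
have ft2 : \forall s \near (0 : R)^'+, sqint (f (t - s)).
  by apply: filterS nr => s [_ s0]; exact: f2.
have Gb : \forall s \near (0 : R)^'+, sqint (fun y => G s y ^+ 2) /\
    L2norm (fun y => G s y ^+ 2) <= L2norm (fun y => g y ^+ 2).
  by apply: filterS nr => s [/ltW s0 _]; split; [exact: GG2|exact: GG_bounded].
have T1 : \int[mu]_y ((f (t - s) y - f t y) * G s y ^+ 2) @[s --> (0 : R)^'+] --> 0
  := L2norm_cvg_ip0 (f2 t0) ft2 fcvg Gb.
have uC : \forall s \near (0 : R)^'+, sqint (fun y => G s y ^+ 2 - g y ^+ 2) /\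
    L2norm (fun y => G s y ^+ 2 - g y ^+ 2) <= 2 * L2norm (fun y => g y ^+ 2).
  apply: filterS nr => s [/ltW s0 _]; split; first by apply: sqintB => //; exact: GG2.
  apply: le_trans (L2normB (GG2 s0) gg2) _.
  by have := GG_bounded s0; lra.
have uL1 : \int[mu]_y `|G s y ^+ 2 - g y ^+ 2| @[s --> (0 : R)^'+] --> 0.
  have H : L2norm (fun y => G s y - g y) * (2 * L2norm g) @[s --> (0 : R)^'+] --> 0.
    rewrite -[X in _ --> X](mul0r (2 * L2norm g)); apply: cvgMl.
    exact: op_cvg0.
  apply: (squeeze_cvgr _ (cvg_cst 0) H); near=> s.
  rewrite Rintegral_ge0//=; have := @GG_L1 0 s (lexx 0); rewrite G0; apply.
  by apply: ltW; have [] : 0 < s /\ 0 < t - s by near: s.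
have T2 : \int[mu]_y (f t y * (G s y ^+ 2 - g y ^+ 2)) @[s --> (0 : R)^'+] --> 0
  := weak_cvg0 (f2 t0) uC uL1.
pose p s := \int[mu]_y ((f (t - s) y - f t y) * G s y ^+ 2) +
  \int[mu]_y (f t y * (G s y ^+ 2 - g y ^+ 2)).
have T12 : p s @[s --> (0 : R)^'+] --> 0.
  by rewrite -[X in _ --> X]addr0; apply: cvgD; [exact: T1|exact: T2].
have T3 : p s + \int[mu]_y (f t y * g y ^+ 2) @[s --> (0 : R)^'+] --> \int[mu]_y (f t y * g y ^+ 2).
  by rewrite -[X in _ --> X]add0r; apply: cvgD; [exact: T12|exact: cvg_cst].
apply: near_cvg T3; near=> s.
have [/ltW s0 ts0] : 0 < s /\ 0 < t - s by near: s.
have i1 := sqintM_intg (sqintB (f2 ts0) (f2 t0)) (GG2 s0).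
have i2 := sqintM_intg (f2 t0) (sqintB (GG2 s0) gg2).
have i3 := sqintM_intg (f2 t0) gg2.
rewrite /p /poincare_interp -RintegralD// -RintegralD//; last exact: intgD.
by apply: eq_Rintegral => y _; ring.
Unshelve. all: by end_near. Qed.

Lemma poincare_interp_ge s : 0 < s -> s < t ->
  \int[mu]_y (f t y * g y ^+ 2) - 2 * K * s <= poincare_interp s.
Proof.
move=> s0 st.
have der r : 0 < r -> r < t -> is_derive r (1 : R) poincare_interp
    (- (\int[mu]_y (L (f (t - r)) y * G r y ^+ 2)) +
    2 * \int[mu]_y (L (G r) y * (f (t - r) y * G r y))).
  by move=> r0 rt; apply: slope_is_derive; exact: poincare_interp_slope.
(* The derivative is known only inside []0, t[], so the mean value theorem is used on [[r, s]]
   before [r] tends to [0+]. *)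
have mono r : 0 < r -> r < s -> poincare_interp r - 2 * K * (s - r) <= poincare_interp s.
  move=> r0 rs.
  have [||c] := @MVT R poincare_interp (fun r =>
      - (\int[mu]_y (L (f (t - r)) y * G r y ^+ 2)) +
      2 * \int[mu]_y (L (G r) y * (f (t - r) y * G r y))) r s rs.
  - move=> y; rewrite in_itv/= => /andP[ry ys]; apply: der.
      exact: lt_trans ry.
    exact: lt_trans st.
  - apply: derivable_within_continuous => y; rewrite in_itv/= => /andP[ry ys].
    have y0 : 0 < y by exact: lt_le_trans ry.
    have yt : y < t by exact: le_lt_trans st.
    by have := der y y0 yt => -[].
  rewrite in_itv/= => /andP[rc cs] E1.
  have Hl := poincare_slope_ge (lt_trans r0 rc) (lt_trans cs st).
  have : - (2 * K) * (s - r) <= poincare_interp s - poincare_interp r.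
    by rewrite E1; apply: ler_wpM2r => //; rewrite subr_ge0 ltW.
  by lra.
have H : poincare_interp r - 2 * K * (s - r) @[r --> (0 : R)^'+] -->
    \int[mu]_y (f t y * g y ^+ 2) - 2 * K * (s - 0).
  apply: cvgB; first exact: poincare_interp_cvg0.
  apply: cvgMr; apply: cvgB; first exact: cvg_cst.
  exact: cvg_at_right_filter cvg_id.
rewrite subr0 in H; apply: (cvgr_to_le H); near=> r; exact: mono.
Unshelve. all: by end_near. Qed.

(** Since the derivative of [ln] at [f t] is [1 / f t], the chain rule absorbs the weight:
    [f t * Gam g g = Gam (f t) g]. In the integral of the latter, [L (f t * g)] has mean 0 and the
    other two terms agree by symmetry. *)
Lemma carre_lnE : K = - (\int[mu]_y (L (f t) y * ln (f t y))).
Proof.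
have chain : chain_rule mu P (@ln R) (f t) g by case: XP => _ /(_ _ t0)[].
have [_ A _] := diff_genval SP XP t0; have [_ B _] := diff_ln_genval SP XP t0.
have FG := diff_mul_genval SP XP t0; have [_ C _] := FG.
have i1 := sqint_intg C; have i2 := sqintM_intg (f2 t0) B; have i3 := sqintM_intg g2 A.
have i4 := intgZ 2^-1 (intgB (intgB i1 i2) i3).
have E1 : {ae mu, forall y, f t y * Gam g g y = carre_du_champ mu P (f t) g y}.
  apply: filterS2 chain (diff_gt0 XP t0) => y /= /(_ Logic.I) + fy.
  rewrite derive1E; have [_ ->] := is_derive1_ln fy; move=> ->.
  by rewrite mulrA divff ?mul1r// gt_eqF.
rewrite /K (ae_Rintegral _ _ E1); last 2 first.
- exact: intg_measurable intg_carre_ln.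
- exact: intg_measurable i4.
rewrite (_ : \int[mu]_y Gam (f t) g y =
  \int[mu]_y (2^-1 * (L (f t \* g) y - f t y * L g y - g y * L (f t) y)))//.
rewrite RintegralZl//; last exact: intgB (intgB i1 i2) i3.
rewrite RintegralB//; last exact: intgB.
rewrite RintegralB// (genval_mean0 SP FG).
rewrite -(genval_sym SP (diff_genval SP XP t0) (diff_ln_genval SP XP t0)).
rewrite (_ : \int[mu]_y (g y * L (f t) y) = \int[mu]_y (L (f t) y * ln (f t y))); last first.
  by apply: eq_Rintegral => y _; rewrite mulrC.
by field.
Qed.

End local_poincare.

(** * Behaviour of the backward martingale at time 0+ *)

Section level_sets.
Variable R : realType.

(** The middle term is [y] rounded up to a multiple of [h]. *)
Lemma riemann_count (h y : R) (N : nat) : 0 < h -> 0 <= y -> y <= h * N%:R ->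
  y <= h * \sum_(j < N) ((h * j%:R < y)%R : bool)%:R <= y + h.
Proof.
move=> h0 y0; elim: N => [|N IH].
  by rewrite mulr0 big_ord0 mulr0 => yl; rewrite (le_anti (_ : 0 <= y <= 0)) ?y0//=; apply/andP; split; lra.
move=> yN; have [yhN|hNy] := leP y (h * N%:R).
  by rewrite big_ord_recr/= ltNge yhN/= addr0; exact: IH.
rewrite (eq_bigr (fun=> 1)); last first.
  move=> j _; rewrite (le_lt_trans _ hNy)//.
  by apply: ler_wpM2l; [exact: ltW|rewrite ler_nat -ltnS ltn_ord].
rewrite sumr_const card_ord -mulr_natr mul1r yN/=.
by rewrite -natr1 mulrDr mulr1 lerD2r ltW.
Qed.

Context d (T : measurableType d) (m : probability T R).
Implicit Types M Z : T -> R.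
Local Notation sqint := (sqint m).
Local Notation L2norm := (L2norm m).

Let level M c := [set x | c < M x].

Lemma sqint_level M c : measurable_fun setT M -> sqint (\1_(level M c)).
Proof. by move=> mM; apply: sqint_indic; exact: measurable_gtr. Qed.

Let orth_sum (phi : nat -> T -> R) Z (N : nat) : sqint Z -> (forall j, sqint (phi j)) ->
  (forall j, \int[m]_x (phi j x * Z x) = 0) ->
  sqint (fun x => \sum_(j < N) phi j x) /\ \int[m]_x ((\sum_(j < N) phi j x) * Z x) = 0.
Proof.
move=> Z2 phi2 phi0; elim: N => [|N [IH2 IH]].
  under eq_fun do rewrite big_ord0; under eq_Rintegral do rewrite big_ord0 mul0r.
  by split; [exact: (sqint_cst m 0)|rewrite Rint_cst].
under eq_fun do rewrite big_ord_recr/=; split; first exact: sqintD.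
under eq_Rintegral do rewrite big_ord_recr/= mulrDl.
rewrite RintegralD//; [|exact: sqintM_intg|exact: sqintM_intg].
by rewrite IH phi0 addr0.
Qed.

Let orth_bounded M Z (K : R) : 0 < K -> measurable_fun setT M ->
  (forall x, `|M x| <= K) -> sqint Z -> \int[m]_x Z x = 0 ->
  (forall c, \int[m]_x (\1_(level M c) x * Z x) = 0) ->
  \int[m]_x (M x * Z x) = 0.
Proof.
move=> K0 mM MK Z2 Z0 MZ; have M2 := sqint_bounded m mM MK.
have Zi := sqint_intg Z2; have MZi := sqintM_intg M2 Z2.
have nZi := intg_norm Zi.
have main (N : nat) : `|\int[m]_x (M x * Z x)| <= (2 * K / N.+1%:R) * \int[m]_x `|Z x|.
  (* [N + 1] steps of this mesh cover [[0, 2 K]], which contains the values of [M + K]. *)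
  set h := 2 * K / N.+1%:R; have h0 : 0 < h by rewrite divr_gt0// mulr_gt0.
  pose phi j x := \1_(level M (h * j%:R - K)) x : R.
  pose S x := h * (\sum_(j < N.+1) phi j x).
  have [s2 s0] := @orth_sum phi Z N.+1 Z2 (fun j => sqint_level _ mM) (fun j => MZ _).
  have S2 : sqint S := sqintZ h s2.
  have SZ : \int[m]_x (S x * Z x) = 0.
    rewrite /S; under eq_Rintegral do rewrite -mulrA.
    by rewrite RintegralZl ?s0 ?mulr0//; exact: sqintM_intg.
  have SM x : `|S x - (M x + K)| <= h.
    have := MK x; rewrite ler_norml => /andP[m1 m2].
    have y0 : 0 <= M x + K by lra.
    have yN : M x + K <= h * N.+1%:R by rewrite /h divfK//; lra.
    have := riemann_count h0 y0 yN; rewrite (eq_bigr (fun j : 'I_N.+1 => phi j x)).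
      rewrite -/(S x) => /andP[a b]; rewrite ger0_norm; lra.
    move=> j _; rewrite /phi indicE; congr (_%:R); congr nat_of_bool.
    by apply/idP/idP; rewrite inE /level /=; lra.
  have D2 : sqint (fun x => S x - (M x + K)).
    by apply: sqintB => //; apply: sqintD => //; exact: (sqint_cst m K).
  have E : \int[m]_x ((S x - (M x + K)) * Z x) = - \int[m]_x (M x * Z x).
    transitivity (\int[m]_x (S x * Z x - (M x * Z x + K * Z x))).
      by apply: eq_Rintegral => x _; ring.
    have KZi := intgZ K Zi; have SZi := sqintM_intg S2 Z2.
    have MKi := intgD MZi KZi.
    by rewrite RintegralB// RintegralD// RintegralZl// SZ Z0 mulr0 addr0 sub0r.
  rewrite -normrN -E; apply: le_trans (le_normr_Rintegral measurableT (sqintM_intg D2 Z2)) _.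
  rewrite -RintegralZl//; apply: le_Rintegral => //.
  - by apply: intg_norm; exact: sqintM_intg.
  - exact: intgZ.
  - by move=> x _; rewrite normrM ler_wpM2r.
apply/eqP; rewrite -normr_eq0 eq_le normr_ge0 andbT.
have H : (2 * K * \int[m]_x `|Z x|) * (N.+1%:R)^-1 @[N --> \oo] --> (2 * K * \int[m]_x `|Z x|) * 0.
  by apply: cvgMr; exact: cvg_harmonic.
rewrite mulr0 in H; apply: (cvgr_to_ge H); apply: nearW => N.
by apply: le_trans (main N) _; rewrite mulrAC.
Qed.

(* [M] is a uniform limit of Riemann sums of the indicators of its level sets. *)
Lemma orth_level_sets M Z : sqint M -> sqint Z -> \int[m]_x Z x = 0 ->
  (forall c, \int[m]_x (\1_[set x | c < M x] x * Z x) = 0) ->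
  \int[m]_x (M x * Z x) = 0.
Proof.
move=> M2 Z2 Z0 MZ; apply/eqP; rewrite -normr_eq0 eq_le normr_ge0 andbT.
have mM := M2.1.
apply/ler_addgt0Pr => e e0; rewrite add0r.
have nZ1 : 0 < L2norm Z + 1 by rewrite ltr_wpDl// L2norm_ge0.
have [|K K0 he] := @clip_approximation _ _ _ m M (e / (L2norm Z + 1)) M2.
  by rewrite divr_gt0.
set C := fun x => Num.max (- K) (Num.min (M x) K).
have CK x : `|C x| <= K.
  rewrite ler_norml /C le_max lexx/= ge_max ge_min lexx orbT andbT; lra.
have mC : measurable_fun setT C by apply: measurable_maxr => //; exact: measurable_minr.
have C2 := sqint_bounded m mC CK.
have CZ : \int[m]_x (C x * Z x) = 0.
  (* A level set of the truncation is the whole space for [c < - K], empty for [c >= K], and that of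
     [M] in between. *)
  apply: (orth_bounded K0 mC CK Z2 Z0) => c.
  have [cK|Kc] := ltP c (- K).
    rewrite (_ : level C c = setT).
      by under eq_Rintegral do rewrite indicT mul1r.
    by apply/seteqP; split => x //= _; rewrite /level /= lt_max cK.
  have [cK'|Kc'] := ltP c K; last first.
    rewrite (_ : level C c = set0).
      by under eq_Rintegral do rewrite indic0 mul0r; rewrite Rint_cst.
    apply/seteqP; split => x //=; rewrite /level /= => h.
    by have := CK x; rewrite leNgt => /negP; apply; rewrite (lt_le_trans _ (ler_norm _))// (le_lt_trans Kc').
  rewrite -[RHS](MZ c); congr (Rintegral _ _ _); apply/funext => x; congr (\1_ _ x * _).
  apply/seteqP; split => y; rewrite /level /C /= lt_max lt_min cK' andbT.
    by rewrite ltNge Kc.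
  by move=> ->; rewrite orbT.
have D2 := sqintB M2 C2.
have -> : \int[m]_x (M x * Z x) = \int[m]_x ((M x - C x) * Z x).
  under [RHS]eq_Rintegral do rewrite mulrBl.
  by rewrite RintegralB ?CZ ?subr0//; exact: sqintM_intg.
apply: le_trans (cauchy_schwarz D2 Z2) _.
apply: (@le_trans _ _ (e / (L2norm Z + 1) * L2norm Z)).
  by rewrite ler_wpM2r ?L2norm_ge0// ltW.
by rewrite mulrAC ler_pdivrMr// ler_wpM2l ?ltW// ltrDl.
Qed.

End level_sets.

(** * Tail events of a rapidly converging sequence *)

Section tail_event.
Context d (T : measurableType d) (R : realType) (m : probability T R).
Variables (N : nat -> T -> R) (a e : R).
Hypothesis N2 : forall k, sqint m (N k).
Hypothesis N_fast : forall k,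
  L2norm m (fun x => N k.+1 x - N k x) <= (2 ^ k.+1)%:R^-1.
Hypothesis e0 : 0 < e.

Let above n := \bigcup_k [set x | a + e < N (n + k)%N x].

(** The event that [N n > a + e] for infinitely many [n]. It depends on no initial segment of the
    sequence, so along times decreasing to 0 it belongs to [F_(0+)]. *)
Definition tail_above := \bigcap_n above n.

Hypothesis orth : forall n, \int[m]_x (\1_tail_above x * (N n x - a)) = 0.

Let mabove n : measurable (above n).
Proof.
by apply: bigcupT_measurable => k; apply: measurable_gtr; case: (N2 (n + k)).
Qed.

Let mtail : measurable tail_above. Proof. exact: bigcapT_measurable. Qed.

(** The variation of the sequence from rank [n] on, an upper bound for all increments
    [N (n + k) - N n] at once. *)
Let D n x : \bar R := (\sum_(0 <= j <oo) `|N (n + j).+1 x - N (n + j)%N x|%:E)%E.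

Let mD n : measurable_fun setT (D n).
Proof.
apply: ge0_emeasurable_sum => // k _.
apply/measurable_EFinP; apply: measurableT_comp => //.
by case: (sqintB (N2 (n + k).+1) (N2 (n + k))).
Qed.

Let D0 n x : (0 <= D n x)%E. Proof. by apply: nneseries_ge0 => k _ _; rewrite lee_fin. Qed.

Let intD n : (\int[m]_x D n x <= (2 ^ n)%:R^-1%:E)%E.
Proof.
rewrite integral_nneseries//; last first.
  move=> k; apply/measurable_EFinP; apply: measurableT_comp => //.
  by case: (sqintB (N2 (n + k).+1) (N2 (n + k))).
have p0 : 0 <= (2 ^ n)%:R^-1 :> R by rewrite invr_ge0.
apply: le_trans (epsilon_trick0 xpredT p0).
apply: lee_nneseries => k _; first by move=> _; apply: integral_ge0 => x _; rewrite lee_fin.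
have Nk := sqintB (N2 (n + k).+1) (N2 (n + k)).
have fin := integrable_fin_num measurableT (intg_norm (sqint_intg Nk)).
rewrite -[leLHS](fineK fin) lee_fin; apply: le_trans (L1_le_L2norm Nk) _.
by apply: le_trans (N_fast _) _; rewrite -addnS expnD natrM invfM.
Qed.

Let N_le n k x : ((N (n + k)%N x - N n x)%:E <= D n x)%E.
Proof.
apply: le_trans (nneseries_lim_ge (m := 0) k _); last by move=> j _ _; rewrite lee_fin.
rewrite sumEFin lee_fin.
rewrite -[leLHS](_ : \sum_(0 <= j < k) (N (n + j).+1 x - N (n + j)%N x) = _).
  by apply: ler_sum => j _; exact: ler_norm.
have := telescope_sumr (fun j => N (n + j)%N x) (leq0n k); rewrite addn0 => <-.
by apply: eq_bigr => j _; rewrite addnS.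
Qed.

Let fineD_le n x : ((fine (D n x))%:E <= D n x)%E.
Proof. by have := D0 n x; case: (D n x) => //= ?; rewrite leey. Qed.

Let intg_fineD n : m.-integrable setT (EFin \o (fun x => fine (D n x))).
Proof.
apply/integrableP; split.
  by apply/measurable_EFinP; exact: measurableT_comp.
apply: le_lt_trans (ltry (2 ^ n)%:R^-1); apply: le_trans (intD n).
apply: ge0_le_integral => //.
- apply: measurableT_comp => //; apply/measurable_EFinP.
  exact: measurableT_comp.
- by move=> x _; rewrite /= ger0_norm ?fine_ge0.
Qed.

Let Rint_fineD n : \int[m]_x fine (D n x) <= (2 ^ n)%:R^-1.
Proof.
have fin := integrable_fin_num measurableT (intg_fineD n).
rewrite -lee_fin /Rintegral (fineK fin); apply: le_trans (intD n).
apply: ge0_le_integral => //.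
- by move=> x _; rewrite lee_fin fine_ge0.
- by apply/measurable_EFinP; exact: measurableT_comp.
- by move=> x _; exact: fineD_le.
Qed.

Let D_fin n : {ae m, forall x, D n x \is a fin_num}.
Proof.
have : m.-integrable setT (D n).
  apply/integrableP; split => //.
  apply: le_lt_trans (ltry (2 ^ n)%:R^-1); apply: le_trans (intD n).
  by rewrite le_eqVlt; apply/orP; left; apply/eqP; apply: eq_integral => x _; rewrite gee0_abs.
by move=> /(integrable_ae measurableT); apply: filterS => x /(_ I).
Qed.

(* On the tail event some [N (n + k)] exceeds [a + e], hence [N n] exceeds
   [a + e - D n], while [D n] has mean at most [2 ^- n]. *)
Lemma tail_above_null : m tail_above = 0%E.
Proof.
have le n : e * fine (m tail_above) <= (2 ^ n)%:R^-1.
  have i1 := sqint_indic m mtail.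
  have i2 := sqintB (N2 n) (sqint_cst m a).
  have i3 := sqintM_intg i1 i2; have i4 := intg_fineD n.
  have <- : \int[m]_x \1_tail_above x = fine (m tail_above).
    by rewrite /Rintegral integral_indic// setIT.
  rewrite -RintegralZl//; last exact: sqint_intg.
  (* The first summand integrates to 0 by [orth], which leaves the mean of [D n]. *)
  apply: (@le_trans _ _ (\int[m]_x (\1_tail_above x * (N n x - a) + fine (D n x)))).
    apply: ae_le_Rintegral; [exact: intgZ (sqint_intg i1)|exact: intgD|].
    apply: filterS (D_fin n) => x Dx; rewrite indicE.
    have [xA|_] := boolP (x \in tail_above); last first.
      by rewrite mulr0 mul0r add0r fine_ge0.
    rewrite mulr1 mul1r; move: xA; rewrite inE => /(_ n I)[k _] /= lt_N.
    have := N_le n k x; rewrite -(fineK Dx) lee_fin; lra.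
  by rewrite RintegralD// orth add0r.
have mA0 : fine (m tail_above) = 0.
  apply/eqP; rewrite eq_le fine_ge0// andbT -(pmulr_rle0 _ e0).
  have H : geometric (1 : R) 2^-1 n @[n --> \oo] --> 0.
    by apply: cvg_geometric; rewrite ger0_norm// invf_lt1// ltr1n.
  apply: (cvgr_to_ge H); apply: nearW => n; rewrite /= mul1r exprVn -natrX.
  exact: le.
by rewrite -(fineK (_ : m tail_above \is a fin_num)) ?mA0// fin_num_measure.
Qed.

(** Continuity from above along the sets [above n], which decrease to the null tail event. *)
Lemma above_cvg0 : fine (m [set x | a + e < N n x]) @[n --> \oo] --> (0 : R).
Proof.
have dec : {homo above : n k / (n <= k)%N >-> (k <= n)%O}.
  move=> n k nk; apply/subsetPset => x [j _ h]; exists (k - n + j)%N => //.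
  by rewrite addnA subnKC.
have fin n : m (above n) \is a fin_num by exact: fin_num_measure.
have H : (m \o above) n @[n --> \oo] --> m tail_above.
  by apply: nonincreasing_cvg_mu => //; rewrite (le_lt_trans (probability_le1 _ _)) ?ltry.
rewrite tail_above_null in H; move/fine_cvgP : H => [_ H].
apply: (squeeze_cvgr _ (cvg_cst 0) H); apply: nearW => n.
have mN : measurable [set x | a + e < N n x] by apply: measurable_gtr; case: (N2 n).
rewrite fine_ge0//= fine_le//; first exact: fin_num_measure.
apply: le_measure; rewrite ?inE// => x /= h.
by exists 0%N => //=; rewrite addn0.
Qed.

End tail_event.

(** * Limit of the martingale at time [0+] *)

Section initial_trace.
Context (R : realType) (d : measure_display) (E : measurableType d).
Context (d' : measure_display) (Om : measurableType d').
Variables (PP : probability Om R) (P : R -> R.-pker E ~> E).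
Variables (X : R -> Om -> E) (x : E).
Hypothesis MP : markov_process PP X P x.
Implicit Types (r s t u : R) (A : set Om).
Local Notation op := (semigroup_op P).

Lemma right_filtration_le s t : s <= t -> right_filtration X s `<=` right_filtration X t.
Proof.
move=> st A sA u /=; rewrite in_itv/= andbT => tu; apply: sA.
by rewrite /= in_itv/= andbT (le_lt_trans st).
Qed.

Lemma natural_filtration_bigcap t (B : nat -> set Om) :
  (forall n, natural_filtration X t (B n)) -> natural_filtration X t (\bigcap_n B n).
Proof.
move=> Bt; rewrite -[\bigcap_n B n]setCK setC_bigcap -setTD.
apply: sigma_algebraCD; apply: sigma_algebra_bigcup => n.
by rewrite -setTD; apply: sigma_algebraCD; exact: Bt.
Qed.

(** For each [u > 0], dropping the terms before the first ranks with [r n <= u] does not change the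
    event, and the remaining ones are observable by time [u]. *)
Lemma tail_above_right_filtration (H : nat -> E -> R) (r : nat -> R) (a e : R) :
  (forall n, measurable_fun setT (H n)) -> (forall n, 0 <= r n) ->
  (forall n, r n.+1 <= r n) ->
  (forall u, 0 < u -> exists n, r n <= u) ->
  right_filtration X 0 (tail_above (fun n w => H n (X (r n) w)) a e).
Proof.
move=> mH r0 rdec rcvg u /=; rewrite in_itv/= andbT => u0.
have [n0 rn0] := rcvg u u0.
have rle n k : r (n + k)%N <= r n.
  by elim: k => [|k IH]; rewrite ?addn0// addnS (le_trans (rdec _)).
have -> : tail_above (fun n w => H n (X (r n) w)) a e =
    \bigcap_n \bigcup_k [set w | a + e < H (n0 + n + k)%N (X (r (n0 + n + k)%N) w)].
  apply/seteqP; split => w h n _; first exact: (h (n0 + n)%N I).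
  have [k _ hk] := h n I; exists (n0 + k)%N => //=.
  by rewrite addnA (addnC n).
apply: natural_filtration_bigcap => n; apply: sigma_algebra_bigcup => k.
apply: (@natural_filtration_le _ _ _ _ _ X (r (n0 + n + k)%N)).
  by rewrite -addnA; apply: le_trans (rle _ _) rn0.
apply: (@natural_filtration_preimage _ _ _ _ _ X _
  [set y | a + e < H (n0 + n + k)%N y]) => //.
exact: measurable_gtr.
Qed.

Variables (t : R) (g : E -> R).
Hypothesis t0 : 0 < t.
Hypothesis mg : measurable_fun setT g.
Let Y w := g (X t w).
Let M r w := op (t - r) g (X r w).
Hypothesis Y2 : sqint PP Y.
Hypothesis M2 : forall r, 0 < r -> r < t -> sqint PP (M r).
Let a := \int[PP]_w Y w.
Let V r := \int[PP]_w (M r w ^+ 2).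

Let cond r A : 0 <= r -> r <= t -> right_filtration X r A ->
  \int[PP]_w (\1_A w * Y w) = \int[PP]_w (\1_A w * M r w).
Proof.
move=> r0 rt rA; have tr0 : 0 <= t - r by rewrite subr_ge0.
have rtr : r + (t - r) = t by rewrite addrC subrK.
have := @markov_Rintegral _ _ _ _ _ _ _ _ _ MP r (t - r) A g r0 tr0 mg.
by rewrite rtr => /(_ (sqint_intg Y2) rA).
Qed.

(** At [r = 0] the variable [M 0] is almost surely the constant [P_t g (x)], the initial state being
    deterministic; the case [A = setT] identifies this constant with [a]. *)
Let cond0 A : right_filtration X 0 A ->
  \int[PP]_w (\1_A w * Y w) = a * \int[PP]_w \1_A w.
Proof.
have H B : right_filtration X 0 B ->
    \int[PP]_w (\1_B w * Y w) = op t g x * \int[PP]_w \1_B w.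
  move=> B0; have mB := right_filtration_measurable MP B0.
  rewrite (cond (lexx 0) (ltW t0) B0) -RintegralZl//; last exact: intg_indic.
  apply: ae_Rintegral.
  - apply: measurable_funM; first exact: measurable_indic.
    by apply: measurableT_comp; [exact: measurable_op|exact: (measurable_process MP)].
  - by apply: measurable_funM => //; exact: measurable_indic.
  have [_ X0 _] := MP.
  by apply: filterS X0 => w Xw; rewrite /M Xw subr0 mulrC.
move=> A0; rewrite (H _ A0); congr (_ * _).
have := H _ (@right_filtrationT _ _ _ _ _ X 0).
under eq_Rintegral do rewrite indicT mul1r.
under [in RHS]eq_Rintegral do rewrite indicT.
by rewrite Rint_cst mulr1.
Qed.

Let level_filtration r c : 0 <= r -> natural_filtration X r [set w | c < M r w].
Proof.
move=> r0; apply: (@natural_filtration_preimage _ _ _ _ _ X r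
  [set y | c < op (t - r) g y]) => //.
by apply: measurable_gtr; exact: measurable_op.
Qed.

(** [Z - M r] integrates to 0 over every event of [F_(r+)], in particular over the level sets of
    [M r], and is thus orthogonal to [M r]. It serves for [Z = Y] and for [Z = M r'] with
    [r <= r']. *)
Let orth r (Z : Om -> R) : 0 < r -> r < t -> sqint PP Z ->
  (forall A, right_filtration X r A ->
    \int[PP]_w (\1_A w * Z w) = \int[PP]_w (\1_A w * Y w)) ->
  \int[PP]_w (M r w * Z w) = V r.
Proof.
move=> r0 rt Z2 ZY; have M2r := M2 r0 rt.
have ZA A : right_filtration X r A -> \int[PP]_w (\1_A w * (Z w - M r w)) = 0.
  move=> rA; have A2 := sqint_indic PP (right_filtration_measurable MP rA).
  under eq_Rintegral do rewrite mulrBr.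
  rewrite RintegralB//; [|exact: sqintM_intg|exact: sqintM_intg].
  by rewrite ZY// (cond (ltW r0) (ltW rt))// subrr.
have : \int[PP]_w (M r w * (Z w - M r w)) = 0.
  apply: orth_level_sets => //; first exact: sqintB.
    have := ZA _ (@right_filtrationT _ _ _ _ _ X r).
    by under eq_Rintegral do rewrite indicT mul1r.
  move=> c; apply: ZA; apply: natural_right_filtration; exact: level_filtration (ltW r0).
under eq_Rintegral do rewrite mulrBr -expr2.
by rewrite RintegralB; [move/subr0_eq| |exact: sqintM_intg|case: M2r].
Qed.

(** Pythagoras. For [Z = M r'] it makes [V] nondecreasing and turns small variations of [V] into
    small L^2 distances. *)
Let dist r (Z : Om -> R) : 0 < r -> r < t -> sqint PP Z ->
  (forall A, right_filtration X r A ->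
    \int[PP]_w (\1_A w * Z w) = \int[PP]_w (\1_A w * Y w)) ->
  L2norm PP (fun w => Z w - M r w) ^+ 2 = L2norm PP Z ^+ 2 - V r.
Proof.
move=> r0 rt Z2 ZY; have M2r := M2 r0 rt; rewrite !sqr_L2norm.
have i1 := sqintM_intg M2r Z2.
have i2 : PP.-integrable setT (EFin \o (fun w => Z w ^+ 2)) by case: Z2.
have i3 : PP.-integrable setT (EFin \o (fun w => M r w ^+ 2)) by case: M2r.
have i4 := intgZ 2 i1; have i5 := intgB i2 i4.
rewrite (@eq_Rintegral _ _ _ _ _ (fun w => (Z w ^+ 2 - 2 * (M r w * Z w)) + M r w ^+ 2)); last first.
  by move=> w _; ring.
by rewrite RintegralD// RintegralB// RintegralZl// (orth r0 rt Z2 ZY) /V; ring.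
Qed.

Let distM r r' : 0 < r -> r <= r' -> r' < t ->
  L2norm PP (fun w => M r' w - M r w) ^+ 2 = V r' - V r.
Proof.
move=> r0 rr' r't; have r'0 := lt_le_trans r0 rr'.
rewrite dist ?sqr_L2norm//; [exact: le_lt_trans r't|exact: M2|].
move=> A rA; apply/esym/cond; [exact: ltW|exact: ltW|].
exact: right_filtration_le rr' _ rA.
Qed.

Let V_le r r' : 0 < r -> r <= r' -> r' < t -> V r <= V r'.
Proof. by move=> *; rewrite -subr_ge0 -distM ?sqr_ge0. Qed.

Let V_ge0 r : 0 <= V r.
Proof. by apply: Rintegral_ge0 => w _; exact: sqr_ge0. Qed.

(* By the Markov property at time [0+], [Y] is uncorrelated with the limit of
   [M r = E (Y | F_r)] as [r] tends to [0+], which is therefore constant. *)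
Lemma backward_martingale_cvg : exists r : nat -> R,
  [/\ forall n, 0 < r n /\ r n < t, r n @[n --> \oo] --> 0 &
   \int[PP]_w (op (t - r n) g (X (r n) w) ^+ 2) @[n --> \oo] -->
   (\int[PP]_w g (X t w)) ^+ 2].
Proof.
pose S := [set V r | r in `]0, t[%classic].
have S0 : has_inf S.
  split; last by exists 0 => _ [r _ <-].
  by exists (V (t / 2)); exists (t / 2) => //=; by rewrite in_itv/= divr_gt0//= ltr_pdivrMr// ltr_pMr// ltr1n.
pose c := inf S.
have cV r : 0 < r -> r < t -> c <= V r.
  by move=> r0 rt; apply: ge_inf; [case: S0|exists r => //=; rewrite in_itv/= r0].
(* The squared norm of an increment of the martingale is an increment of [V], so being this close to
   the infimum yields increments of norm at most [2 ^- (n + 1)]. *)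
have /choice[rho Hrho] : forall n : nat, exists r, [/\ 0 < r, r < t & V r < c + ((2 ^ n.+1)%:R^-1) ^+ 2].
  move=> n; have p : 0 < ((2 ^ n.+1)%:R^-1) ^+ 2 :> R by rewrite exprn_gt0// invr_gt0 ltr0n expn_gt0.
  have [_ [r + <-] h] := inf_adherent p S0.
  by rewrite /= in_itv/= => /andP[r0 rt]; exists r.
(* Running minima make the times nonincreasing; the cap [t / (n + 2)] in [r] below makes them tend
   to 0. *)
pose mrho := fix F n := if n is k.+1 then Num.min (F k) (rho k.+1) else rho 0%N.
have mrho0 n : 0 < mrho n /\ mrho n < t.
  elim: n => [|n [IH1 IH2]] /=; first by have [] := Hrho 0%N.
  by have [? ? _] := Hrho n.+1; rewrite lt_min IH1 gt_min IH2.
have mrho_le n : mrho n <= rho n by case: n => //= n; rewrite ge_min lexx orbT.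
pose r n := Num.min (mrho n) (t / n.+2%:R).
have tn n : 0 < t / n.+2%:R by rewrite divr_gt0.
have r0 n : 0 < r n by rewrite lt_min tn; have [->] := mrho0 n.
have rt n : r n < t by rewrite gt_min; have [_ ->] := mrho0 n.
have rdec n : r n.+1 <= r n.
  have mdec : mrho n.+1 <= mrho n by rewrite /= ge_min lexx.
  rewrite /r le_min; apply/andP; split.
    by apply: le_trans mdec; rewrite ge_min lexx.
  apply: (@le_trans _ _ (t / n.+3%:R)); first by rewrite ge_min lexx orbT.
  by apply: ler_wpM2l; [exact: ltW|rewrite lef_pV2 ?posrE// ler_nat].
have r_le n : r n <= t / n.+2%:R by rewrite ge_min lexx orbT.
have Vr n : V (r n) - c <= ((2 ^ n.+1)%:R^-1) ^+ 2.
  rewrite lerBlDl; have [? ? h] := Hrho n; apply: le_trans (ltW h).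
  by apply: V_le => //; rewrite ge_min mrho_le.
have rcvg : r n @[n --> \oo] --> 0.
  have H : t * (n.+1%:R)^-1 @[n --> \oo] --> t * 0 by apply: cvgMr; exact: cvg_harmonic.
  rewrite mulr0 in H; apply: (squeeze_cvgr _ (cvg_cst 0) H); apply: nearW => n.
  rewrite ltW//=; apply: le_trans (r_le n) _.
  by apply: ler_wpM2l; [exact: ltW|rewrite lef_pV2 ?posrE// ler_nat].
have rsmall u : 0 < u -> exists n, r n <= u.
  move=> u0; move/cvgr0Pnorm_lt : rcvg => /(_ _ u0)[n _ h]; exists n.
  by apply: ltW; apply: le_lt_trans (ler_norm _) (h n _); rewrite /= leqnn.
exists r; split => //.
pose N n w := M (r n) w.
have N2 n : sqint PP (N n) by exact: M2.
have fast n : L2norm PP (fun w => N n.+1 w - N n w) <= (2 ^ n.+1)%:R^-1.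
  rewrite -L2normN; under eq_fun do rewrite opprB.
  rewrite -(@ler_pXn2r _ 2)// ?nnegrE ?L2norm_ge0// ?invr_ge0// distM//.
  by apply: le_trans (Vr n); rewrite lerB// cV.
have mop n : measurable_fun setT (op (t - r n) g) by exact: measurable_op.
have r0' n : 0 <= r n by exact: ltW.
have condN A n : right_filtration X 0 A ->
    \int[PP]_w (\1_A w * N n w) = a * \int[PP]_w \1_A w.
  move=> A0; rewrite -(cond0 A0) (@cond (r n))//; first exact: ltW.
  exact: right_filtration_le A0.
have orthA A n : right_filtration X 0 A -> \int[PP]_w (\1_A w * (N n w - a)) = 0.
  move=> A0; have mA := right_filtration_measurable MP A0.
  have A2 := sqint_indic PP mA; have Ai := sqint_intg A2.
  have i1 := sqintM_intg A2 (N2 n); have i2 := intgZ a Ai.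
  under eq_Rintegral do rewrite mulrBr (mulrC _ a).
  by rewrite RintegralB// condN// RintegralZl// subrr.
have above (e : R) : 0 < e -> fine (PP [set w | a + e < N n w]) @[n --> \oo] --> (0 : R).
  move=> e0; apply: above_cvg0 => // n; apply: orthA.
  exact: (@tail_above_right_filtration (fun n => op (t - r n) g)).
(* Lower deviations of [N] from [a] are upper deviations of [- N] from [- a]. *)
have below (e : R) : 0 < e -> fine (PP [set w | - a + e < - N n w]) @[n --> \oo] --> (0 : R).
  move=> e0; apply: (@above_cvg0 _ _ _ PP (fun n w => - N n w)) => //.
  - by move=> n; exact: sqintN.
  - move=> n; apply: le_trans (fast n); rewrite -L2normN.
    by under eq_fun do rewrite opprB opprK addrC.
  move=> n; rewrite -oppr0 -(@orthA (tail_above (fun n w => - N n w) (- a) e) n); last first.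
    apply: (@tail_above_right_filtration (fun n y => - op (t - r n) g y)) => // k.
    exact: measurableT_comp.
  rewrite -RintegralN.
    by apply: eq_Rintegral => w _; ring.
  apply: sqintM_intg; last by apply: sqintB => //; exact: (sqint_cst PP a).
  apply: sqint_indic; apply: (right_filtration_measurable MP (s := 0)).
  apply: (@tail_above_right_filtration (fun n y => - op (t - r n) g y)) => // k.
  exact: measurableT_comp.
have uC : \forall n \near \oo, sqint PP (fun w => N n w - a) /\
    L2norm PP (fun w => N n w - a) <= L2norm PP Y + L2norm PP (cst a).
  apply: nearW => n; have a2 := sqint_cst PP a; split; first exact: sqintB.
  apply: le_trans (L2normB (N2 n) a2) _; rewrite lerD2r.
  rewrite -(@ler_pXn2r _ 2)// ?nnegrE ?L2norm_ge0// -subr_ge0 [X in _ - X]sqr_L2norm.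
  by rewrite -(dist (r0 n) (rt n) Y2)// sqr_ge0.
have L1 : \int[PP]_w `|N n w - a| @[n --> \oo] --> 0.
  apply: (measure_cvg_L1 uC) => e e0.
  have H : fine (PP [set w | a + e < N n w]) + fine (PP [set w | - a + e < - N n w])
      @[n --> \oo] --> (0 : R).
    by rewrite -[X in _ --> X]addr0; apply: cvgD; [exact: above|exact: below].
  apply: (squeeze_cvgr _ (cvg_cst 0) H); apply: nearW => n.
  have mN := (N2 n).1; have mNN : measurable_fun setT (fun w => - N n w) by exact: measurableT_comp.
  have m1 : measurable [set w | a + e < N n w] by exact: measurable_gtr.
  have m2 : measurable [set w | - a + e < - N n w] by exact: measurable_gtr.
  have m3 : measurable [set w | e < `|N n w - a|].
    by apply: measurable_gtr; apply: measurableT_comp => //; exact: measurable_funB.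
  rewrite fine_ge0//= -fineD ?fin_num_measure// fine_le ?fin_numD ?fin_num_measure//.
  apply: le_trans (measureU2 _ m1 m2); apply: le_measure; rewrite ?inE//; first exact: measurableU.
  move=> w /=; have [h|h] := leP 0 (N n w - a).
    by rewrite ger0_norm// => ?; left; rewrite /=; lra.
  by rewrite ltr0_norm// => ?; right; rewrite /=; lra.
(* By [orth] the integral of [N n * Y] is [V (r n)], so weak convergence tested on [Y] alone already
   gives the limit [a ^+ 2] of the second moments. *)
have W : \int[PP]_w (Y w * (N n w - a)) @[n --> \oo] --> 0 := weak_cvg0 Y2 uC L1.
have W' : \int[PP]_w (Y w * (N n w - a)) + a ^+ 2 @[n --> \oo] --> a ^+ 2.
  by rewrite -[X in _ --> X]add0r; apply: cvgD; [exact: W|exact: cvg_cst].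
apply: near_cvg W'; apply: nearW => n.
have i1 := sqintM_intg (N2 n) Y2; have i2 := intgZ a (sqint_intg Y2).
rewrite (@eq_Rintegral _ _ _ _ _ (fun w => N n w * Y w - a * Y w)); last by move=> w _; ring.
rewrite RintegralB// RintegralZl//; last exact: sqint_intg.
rewrite (orth (r0 n) (rt n) Y2)// -[X in a * X]/a expr2 subrK.
by [].
Qed.

End initial_trace.

(** * Bound on the varentropy *)

Section varentropy_bound.
Context (R : realType) (d : measure_display) (E : measurableType d).
Variables (mu : probability E R) (P : R -> R.-pker E ~> E).
Context (d' : measure_display) (Om : measurableType d').
Variables (PP : probability Om R) (X : R -> Om -> E) (x : E) (f : R -> E -> R).
Hypothesis SP : symmetric_markov_semigroup mu P.
Hypothesis XP : nonneg_curved_diffusion mu PP P X x f.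
Variable t : R.
Hypothesis t0 : 0 < t.
Local Notation g := (@ln R \o f t).

Let MP : markov_process PP X P x. Proof. by case: XP. Qed.
Let mX r : 0 <= r -> measurable_fun setT (X r).
Proof. exact: (measurable_process MP). Qed.
Let f2 r : 0 < r -> sqint mu (f r). Proof. exact: (diff_sqint SP XP). Qed.
Let g2 : sqint mu g. Proof. exact: (diff_ln_sqint SP XP). Qed.
Let gg2 : sqint mu (fun y => g y ^+ 2).
Proof.
have [H _ _] := diff_lnsqr_genval SP XP t0.
by under eq_fun do rewrite expr2.
Qed.

Let Y2 : sqint PP (fun w => g (X t w)).
Proof.
split; first by apply: measurableT_comp; [case: g2|exact: mX (ltW t0)].
have fgg := sqintM_intg (f2 t0) gg2.
exact: (intg_densityP (mX (ltW t0)) (diff_density XP t0) gg2.1).2 fgg.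
Qed.

Lemma varentropyE : varentropy PP (X t) (f t) =
  \int[mu]_y (f t y * g y ^+ 2) - (\int[PP]_w g (X t w)) ^+ 2.
Proof.
set a := \int[PP]_w _.
have Yi : PP.-integrable setT (EFin \o (fun w => g (X t w) ^+ 2)) by case: Y2.
have i1 := intgZ (2 * a) (sqint_intg Y2); have i2 := intgB Yi i1.
have i3 := intg_cst PP (a ^+ 2).
have mgg : measurable_fun setT (fun y => g y ^+ 2) by case: gg2.
have <- : \int[PP]_w g (X t w) ^+ 2 = \int[mu]_y (f t y * g y ^+ 2).
  apply: (Rintegral_density (mX (ltW t0)) (diff_density XP t0) mgg).
  by apply: sqintM_intg => //; exact: f2.
transitivity (\int[PP]_w ((g (X t w) ^+ 2 - (2 * a) * g (X t w)) + a ^+ 2)).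
  rewrite /varentropy /variance !unlock.
  congr fine; apply: eq_integral => w _; congr EFin.
  by rewrite fctE /= -[fine _]/a; ring.
rewrite RintegralD// RintegralB// RintegralZl//; last exact: sqint_intg.
by rewrite Rint_cst -/a; ring.
Qed.

Let V_sqint s : 0 <= s -> sqint mu (fun y => semigroup_op P s g y ^+ 2).
Proof.
move=> s0; have curv : nonneg_curvature mu P g by case: XP => _ /(_ _ t0)[].
have [_ D _] := curv s s0; have [H _ _] := generator_genval SP D.
by under eq_fun do rewrite expr2.
Qed.

Lemma varentropy_le : varentropy PP (X t) (f t) <=
  - (2 * t * \int[mu]_y (generator mu P (f t) y * ln (f t y))).
Proof.
have mg : measurable_fun setT g by case: g2.
have V2 r : 0 < r -> r < t -> 
    mu.-integrable setT (EFin \o (fun y => f r y * semigroup_op P (t - r) g y ^+ 2)).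
  move=> r0 rt; apply: sqintM_intg; first exact: f2.
  by apply: V_sqint; rewrite subr_ge0 ltW.
have mV r : measurable_fun setT (fun y => semigroup_op P (t - r) g y ^+ 2).
  by apply: measurable_funX; exact: measurable_op.
have M2 r : 0 < r -> r < t -> sqint PP (fun w => semigroup_op P (t - r) g (X r w)).
  move=> r0 rt; split.
    by apply: measurableT_comp; [exact: measurable_op|exact: mX (ltW r0)].
  exact: (intg_densityP (mX (ltW r0)) (diff_density XP r0) (mV r)).2 (V2 r r0 rt).
have [r [r0t rcvg Vcvg]] := backward_martingale_cvg MP t0 mg Y2 M2.
set a := \int[PP]_w _ in Vcvg; set J := \int[mu]_y _.
have K := carre_lnE SP XP t0.
have H : \int[PP]_w (semigroup_op P (t - r n) g (X (r n) w) ^+ 2) - 2 * J * (t - r n)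
    @[n --> \oo] --> a ^+ 2 - 2 * J * (t - 0).
  apply: cvgB; first exact: Vcvg.
  by apply: cvgMr; apply: cvgB => //; exact: cvg_cst.
rewrite subr0 in H; rewrite varentropyE -/a.
suff : \int[mu]_y (f t y * g y ^+ 2) <= a ^+ 2 - 2 * J * t by lra.
apply: (cvgr_to_ge H); apply: nearW => n; have [r0 rt] := r0t n.
have tr0 : 0 < t - r n by rewrite subr_gt0.
have trt : t - r n < t by rewrite ltrBlDr ltrDl.
(* At [s = t - r n] the interpolation is the second moment of the martingale at time [r n],
   expressed through the density of [X (r n)]. *)
have := poincare_interp_ge SP XP t0 tr0 trt.
rewrite /poincare_interp K (_ : t - (t - r n) = r n); last by ring.
rewrite (Rintegral_density (mX (ltW r0)) (diff_density XP r0) (mV (r n)) (V2 _ r0 rt)).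
by rewrite -/J; lra.
Qed.

End varentropy_bound.

Theorem lemma3 (R : realType) (d : measure_display) (E : measurableType d)
    (mu : probability E R) (P : R -> R.-pker E ~> E)
    (d' : measure_display) (Om : measurableType d') (PP : probability Om R)
    (X : R -> Om -> E) (x : E) (f : R -> E -> R) :
  symmetric_markov_semigroup mu P ->
  nonneg_curved_diffusion mu PP P X x f ->
  forall t : R, 0 < t ->
    derivable (fun s : R => entropy PP (X s) (f s)) t 1 /\
    derive1 (fun s : R => entropy PP (X s) (f s)) t
      <= - (varentropy PP (X t) (f t) / (2 * t)).
Proof.
move=> SP XP t t0.
have [D DE] := slope_is_derive (F := fun s => entropy PP (X s) (f s)) (entropy_cvg SP XP t0).
split=> //; rewrite derive1E DE.
have t20 : 0 < 2 * t by rewrite mulr_gt0.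
rewrite lerNr ler_pdivrMr//; apply: le_trans (varentropy_le SP XP t0) _.
by lra.
Qed.
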